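(* Let $X$, $Y$ be complex Banach spaces, and let $f\in\mathcal{H}(X;Y)$. Then $f\in\mathcal{H}_{wbu}(X;Y)$ if and only if there are a (complex) Banach space $Z$, a compact operator $S:X\to Z$, and a mapping $g\in\mathcal{H}_{wbu}(Z;Y)$ such that $f=g\circ S$.
   Context: For complex Banach spaces $X$, $Y$, $\mathcal{H}(X;Y)$ denotes the space of all holomorphic mappings from $X$ into $Y$ (defined on all of $X$). $\mathcal{H}_{wbu}(X;Y)$ is the subspace of all $f\in\mathcal{H}(X;Y)$ whose restrictions to bounded subsets of $X$ are weakly uniformly continuous: for every bounded $B\subset X$ and every $\epsilon>0$ there is a weak zero neighbourhood $U$ in $X$ such that $\|f(x)-f(y)\|<\epsilon$ whenever $x,y\in B$ and $x-y\in U$. An operator is a linear continuous mapping. *)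

(* Defs.v *)
From HB Require Import structures.
From mathcomp Require Import all_boot all_order all_algebra.
From mathcomp Require Import complex.
From mathcomp Require Import all_classical all_reals all_analysis.

Set Implicit Arguments.
Unset Strict Implicit.
Unset Printing Implicit Defensive.

Import Order.TTheory GRing.Theory Num.Theory.
Import numFieldNormedType.Exports.

Local Open Scope classical_set_scope.
Local Open Scope ring_scope.

Section Definitions.
Context {K : numFieldType}.
Implicit Types X Y Z : normedModType K.

Definition multilinear X Y (m : nat) (A : ('I_m -> X) -> Y) : Prop :=
  forall (i : 'I_m) (v : 'I_m -> X),
    linear (fun x : X => A (@dfwith _ (fun=> X) v i x)).

Definition homogeneous_polynomial X Y (m : nat) (P : X -> Y) : Prop :=
  continuous P /\
  exists2 A : ('I_m -> X) -> Y, multilinear A & P = fun x => A (fun=> x).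

(* For K the complex numbers, this is holomorphy on the whole of X in the sense
   of locally uniformly convergent power series (Nachbin, Mujica). *)
Definition holomorphic X Y (f : X -> Y) : Prop :=
  forall a : X, exists2 r : K, 0 < r & exists2 P : nat -> X -> Y,
    (forall m, homogeneous_polynomial m (P m)) &
    {uniform ball a r,
      (fun (n : nat) (x : X) => \sum_(0 <= m < n) P m (x - a)) @ \oo --> f}.

(* The neighbourhoods of 0 in the weak topology sigma(X, X'). *)
Definition weak_nbhs0 X (U : set X) : Prop :=
  exists (n : nat) (phi : 'I_n -> {linear X -> K^o}), exists2 e : K, 0 < e &
    (forall i, continuous (phi i)) /\
    [set x : X | forall i, `|phi i x| < e] `<=` U.

Definition weakly_unif_cont_on_bounded X Y (f : X -> Y) : Prop :=
  forall B : set X, bounded_set B -> forall e : K, 0 < e ->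
    exists2 U : set X, weak_nbhs0 U &
      forall x y, B x -> B y -> U (x - y) -> `|f x - f y| < e.

Definition holomorphic_wbu X Y (f : X -> Y) : Prop :=
  holomorphic f /\ weakly_unif_cont_on_bounded f.

Definition compact_operator X Z (S : {linear X -> Z}) : Prop :=
  continuous S /\ forall B : set X, bounded_set B -> precompact (S @` B).

End Definitions.

(* Main.v *)
From HB Require Import structures.
Require Import Defs.
From mathcomp Require Import all_boot all_order all_algebra.
From mathcomp Require Import complex ring lra generic_quotient ring_quotient.
From mathcomp Require Import all_classical all_reals all_analysis.
Import numFieldNormedType.Exports.
Local Open Scope classical_set_scope.
Local Open Scope ring_scope.

(** The factorization is obtained from one seminorm on X. If f = g o S with S
    continuous and g weakly uniformly continuous on bounded sets, then so is f,
    because functionals can be composed with S (wbu_comp). Conversely, let f be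
    weakly uniformly continuous on bounded sets.

    For every k, finitely many functionals give a weakly continuous seminorm
    p k such that p k (x - y) <= 1 forces f x and f y to be 2^-k-close on the
    ball of radius (k + 1)^2, and one may take p k increasing in k. Let q x be
    the infimum of the sums of the numbers
    |s k| / (k + 1) + 4 (k + 1) p k (s k) over the finite decompositions of x
    as a sum of vectors s k. This seminorm has two opposite virtues
    (compact_seminorm). It is small: on a ball of X its first summand is
    negligible for k large, and the second one is totally bounded, so the
    canonical map S from X to the completion Z of (X, q) is compact. It is large: a
    decomposition of x with q x < n can be cut at any level N >= n, since the
    pieces beyond N hardly change f; hence on the q-ball of radius n the map f
    is bounded, and is controlled by p N, whose functionals are q-continuous.

    It remains to extend f to a holomorphic map g on Z. Uniform continuity on
    q-balls gives a continuous extension. The restriction of f to a complex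
    line is an entire function of one variable, and Cauchy's estimates
    (cauchy_taylor, deduced from an elementary maximum principle) show that the
    Taylor polynomials of f are q-uniformly continuous in the base point and in
    the argument, and that the Taylor series converges geometrically on q-unit
    balls. So polynomials and expansions extend to Z by continuity;
    polarization (polar_multilinear, polar_diag) keeps the limits polynomial.
    The control of f by finitely many q-continuous functionals also passes to
    the limit, so g is weakly uniformly continuous on bounded sets. *)

Set Implicit Arguments.
Unset Strict Implicit.
Unset Printing Implicit Defensive.

Import Order.TTheory GRing.Theory Num.Theory.
Local Open Scope complex_scope.
Local Open Scope quotient_scope.

(** * Real-valued norms *)

Section RealNorm.
Context {R : realType}.

(** The norm of a complex normed space takes values in the partially ordered
    field R[i]. Estimates are carried out on its real part, which lives in a
    totally ordered field and determines it. *)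
Definition nr {V : normedZmodType R[i]} (x : V) : R := complex.Re `|x|.

Lemma gt0_complexP (e : R[i]) : 0 < e -> exists2 d : R, 0 < d & e = d%:C.
Proof. by case: e => a b; rewrite ltcE /= => /andP[/eqP -> ?]; exists a. Qed.

Lemma ge0_complexE (e : R[i]) : 0 <= e -> e = (complex.Re e)%:C /\ 0 <= complex.Re e.
Proof. by case: e => a b; rewrite lecE /= => /andP[/eqP -> ->]. Qed.

Section NormedZmod.
Variable V : normedZmodType R[i].
Implicit Types x y : V.

Lemma normE x : `|x| = (nr x)%:C.
Proof. by have [] := ge0_complexE (normr_ge0 x). Qed.

Lemma nr_ge0 x : 0 <= nr x.
Proof. by have [] := ge0_complexE (normr_ge0 x). Qed.

Lemma nrD x y : nr (x + y) <= nr x + nr y.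
Proof. by rewrite -lecR rmorphD /= -!normE ler_normD. Qed.

Lemma nrN x : nr (- x) = nr x.
Proof. by rewrite /nr normrN. Qed.

Lemma nrC x y : nr (x - y) = nr (y - x).
Proof. by rewrite /nr distrC. Qed.

Lemma nr0 : nr (0 : V) = 0.
Proof. by rewrite /nr normr0. Qed.

Lemma nr0_eq0 x : nr x = 0 -> x = 0.
Proof. by move=> x0; apply/eqP; rewrite -normr_eq0 normE x0. Qed.

Lemma nrB x y : nr (x - y) <= nr x + nr y.
Proof. by rewrite -(nrN y) nrD. Qed.

Lemma nr_tri x y z : nr (x - z) <= nr (x - y) + nr (y - z).
Proof. by rewrite -(subrKA y) nrD. Qed.

Lemma nr_sum (I : Type) (r : seq I) (P : pred I) (F : I -> V) :
  nr (\sum_(i <- r | P i) F i) <= \sum_(i <- r | P i) nr (F i).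
Proof.
elim/big_ind2 : _ => //; first by rewrite nr0.
by move=> a b c d ab cd; apply: le_trans (nrD _ _) (lerD ab cd).
Qed.

Lemma nr_leP x (e : R) : (`|x| <= e%:C) = (nr x <= e).
Proof. by rewrite normE lecR. Qed.

Lemma nr_ltP x (e : R) : (`|x| < e%:C) = (nr x < e).
Proof. by rewrite normE ltcR. Qed.

End NormedZmod.

Lemma nrM (c d : R[i]) : nr (c * d) = nr c * nr d.
Proof. by apply: (@complexI R); rewrite rmorphM /= -!normE normrM. Qed.

Lemma nrX (c : R[i]) n : nr (c ^+ n) = nr c ^+ n.
Proof. by apply: (@complexI R); rewrite rmorphXn /= -!normE normrX. Qed.

Lemma nrV (c : R[i]) : nr c^-1 = (nr c)^-1.
Proof. by apply: (@complexI R); rewrite fmorphV /= -!normE normfV. Qed.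

Lemma nr1 : nr (1 : R[i]) = 1.
Proof. by rewrite /nr normr1. Qed.

Lemma nr_real (x : R) : nr x%:C = `|x|.
Proof. by rewrite /nr normc_def /= expr0n addr0 sqrtr_sqr. Qed.

Lemma nrZ (V : normedModType R[i]) (c : R[i]) (x : V) : nr (c *: x) = nr c * nr x.
Proof. by apply: (@complexI R); rewrite rmorphM /= -!normE normrZ. Qed.

End RealNorm.

(** * Limits of sequences and precompactness *)

Section Limits.
Context {R : realType}.

(** Sequential convergence with real error bounds; it is the topological
    convergence (cvg_sconv), but it also applies to R[i] as a mere normed
    group. *)
Definition sconv {V : normedZmodType R[i]} (u : nat -> V) (l : V) : Prop :=
  forall e : R, 0 < e -> exists N, forall n, (N <= n)%N -> nr (u n - l) < e.

Definition scauchy {V : normedZmodType R[i]} (u : nat -> V) : Prop :=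
  forall e : R, 0 < e ->
  exists N, forall n m, (N <= n)%N -> (N <= m)%N -> nr (u n - u m) < e.

Definition seq_complete (V : normedZmodType R[i]) : Prop :=
  forall u : nat -> V, scauchy u -> exists l, sconv u l.

Section NormedZmod.
Variable V : normedZmodType R[i].
Implicit Types (u v : nat -> V) (l m : V).

Lemma sconv_cst l : sconv (fun=> l) l.
Proof. by move=> e e0; exists 0%N => n _; rewrite subrr nr0. Qed.

Lemma sconvD u v l m : sconv u l -> sconv v m -> sconv (fun n => u n + v n) (l + m).
Proof.
move=> ul vm e e0; have e2 : 0 < e / 2 by lra.
have [N1 h1] := ul _ e2; have [N2 h2] := vm _ e2.
exists (maxn N1 N2) => n; rewrite geq_max => /andP[/h1 ? /h2 ?].
rewrite opprD addrACA; apply: le_lt_trans (nrD _ _) _; lra.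
Qed.

Lemma sconvN u l : sconv u l -> sconv (fun n => - u n) (- l).
Proof.
move=> ul e /ul[N hN]; exists N => n /hN.
by rewrite -opprD nrN.
Qed.

Lemma sconvB u v l m : sconv u l -> sconv v m -> sconv (fun n => u n - v n) (l - m).
Proof. by move=> ul /sconvN; apply: sconvD. Qed.

Lemma sconv_sum (I : Type) (r : seq I) (P : pred I) (u : I -> nat -> V) (l : I -> V) :
  (forall i, sconv (u i) (l i)) ->
  sconv (fun n => \sum_(i <- r | P i) u i n) (\sum_(i <- r | P i) l i).
Proof.
move=> ul; elim: r => [|i r IH].
  rewrite big_nil; under [X in sconv X]eq_fun do rewrite big_nil; exact: sconv_cst.
rewrite big_cons; under [X in sconv X]eq_fun do rewrite big_cons.
by case: (P i) => //; apply: sconvD.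
Qed.

(** The bound is only required eventually: this is how every inequality below
    is transferred from the dense subspace to the completion. *)
Lemma sconv_nr_le u l (b : R) N :
  sconv u l -> (forall n, (N <= n)%N -> nr (u n) <= b) -> nr l <= b.
Proof.
move=> ul ub; rewrite leNgt; apply/negP => bl.
have [|M hM] := ul (nr l - b); first by lra.
have := hM (maxn M N) (leq_maxl _ _); have := ub (maxn M N) (leq_maxr _ _).
have := nrD (u (maxn M N)) (l - u (maxn M N)); rewrite subrKC (nrC l); lra.
Qed.

Lemma sconv_uniq u l m : sconv u l -> sconv u m -> l = m.
Proof.
move=> ul um; apply/eqP; rewrite -subr_eq0; apply/eqP/nr0_eq0.
have h : sconv (fun=> 0) (l - m).
  by have := sconvB ul um; under [X in sconv X]eq_fun do rewrite subrr.
apply/eqP; rewrite eq_le nr_ge0 andbT.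
by apply: (sconv_nr_le (N := 0%N) h) => n _; rewrite nr0.
Qed.

Lemma sconv_close u v l :
  sconv u l -> (forall e : R, 0 < e -> exists N, forall n, (N <= n)%N -> nr (v n - u n) < e) ->
  sconv v l.
Proof.
move=> ul uv e e0; have e2 : 0 < e / 2 by lra.
have [N1 h1] := ul _ e2; have [N2 h2] := uv _ e2.
exists (maxn N1 N2) => n; rewrite geq_max => /andP[/h1 ? /h2 ?].
by apply: le_lt_trans (nr_tri _ (u n) _) _; lra.
Qed.

Lemma sconv_nr_lt u l (b : R) :
  sconv u l -> nr l < b -> exists N, forall n, (N <= n)%N -> nr (u n) < b.
Proof.
move=> ul lb; have [|N h] := ul (b - nr l); first by lra.
exists N => n /h; have := nrD (u n - l) l; rewrite subrK; lra.
Qed.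

End NormedZmod.

Lemma sconvZ (V : normedModType R[i]) (c : R[i]) (u : nat -> V) l :
  sconv u l -> sconv (fun n => c *: u n) (c *: l).
Proof.
move=> ul e e0; have c1 : 0 < nr c + 1 by have := nr_ge0 c; lra.
have [|N h] := ul (e / (nr c + 1)); first by rewrite divr_gt0.
exists N => n /h; rewrite ltr_pdivlMr// -scalerBr nrZ.
by have := nr_ge0 (u n - l); have := nr_ge0 c; nra.
Qed.

Lemma cvg_sconv (V : normedModType R[i]) (u : nat -> V) l :
  u @ \oo --> l <-> sconv u l.
Proof.
split=> [/cvgrPdist_lt ul e e0|ul].
  have /ul[N _ hN] : 0 < e%:C by rewrite ltcR.
  by exists N => n /hN /=; rewrite nr_ltP nrC.
apply/cvgrPdist_lt => _ /gt0_complexP[e e0 ->].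
have [N hN] := ul _ e0; exists N => // n /hN /=.
by rewrite nr_ltP nrC.
Qed.

Lemma banach_seq_complete (V : completeNormedModType R[i]) : seq_complete V.
Proof.
move=> u uc; exists (lim (u @ \oo)); apply/cvg_sconv.
apply: cauchy_cvg; apply: cauchy_exP => _ /gt0_complexP[e e0 ->].
have [N hN] := uc _ e0; exists (u N); exists N => // n /= Nn.
by rewrite -ball_normE /= nr_ltP; apply: hN.
Qed.

Lemma nr_ReIm (z : R[i]) : nr z <= `|complex.Re z| + `|complex.Im z|.
Proof.
rewrite {1}[z]complexE; apply: le_trans (nrD _ _) _.
rewrite nrM !nr_real (_ : nr _ = 1) ?mul1r//.
by rewrite /nr normc_def /= expr0n add0r expr1n sqrtr1.
Qed.

Lemma Re_le_nr (z : R[i]) : `|complex.Re z| <= nr z.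
Proof. by have := normc_ge_Re z; rewrite normE lecR. Qed.

Lemma Im_le_nr (z : R[i]) : `|complex.Im z| <= nr z.
Proof.
have := normc_ge_Re (- z * 'i); rewrite ReiNIm raddfN opprK.
rewrite normE lecR nrM nrN (_ : nr 'i = 1) ?mulr1//.
by rewrite /nr normc_def /= expr0n add0r expr1n sqrtr1.
Qed.

(** Real and imaginary parts are 1-Lipschitz, so they are Cauchy sequences of
    reals. *)
Lemma complex_seq_complete : seq_complete R[i].
Proof.
move=> u uc.
have cv (p : R[i] -> R) : (forall z w, `|p z - p w| <= nr (z - w)) ->
    exists l : R, forall e : R, 0 < e -> exists N, forall n, (N <= n)%N -> `|p (u n) - l| < e.
  move=> pl; exists (lim ((p \o u) @ \oo)).
  have : (p \o u) @ \oo --> lim ((p \o u) @ \oo).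
    apply: cauchy_cvg; apply: cauchy_exP => e e0.
    have [N hN] := uc _ e0; exists (p (u N)); exists N => // n /= Nn.
    by rewrite -ball_normE /=; apply: le_lt_trans (pl _ _) _; apply: hN.
  move=> /cvgrPdist_lt pc e /pc[N _ hN]; exists N => n /hN /=.
  by rewrite distrC.
have [a ha] : exists l : R, forall e : R, 0 < e -> exists N, forall n,
    (N <= n)%N -> `|complex.Re (u n) - l| < e.
  by apply: cv => z w; rewrite -raddfB; apply: Re_le_nr.
have [b hb] : exists l : R, forall e : R, 0 < e -> exists N, forall n,
    (N <= n)%N -> `|complex.Im (u n) - l| < e.
  by apply: cv => z w; rewrite -raddfB; apply: Im_le_nr.
exists (a +i* b) => e e0; have e2 : 0 < e / 2 by lra.
have [N1 h1] := ha _ e2; have [N2 h2] := hb _ e2.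
exists (maxn N1 N2) => n; rewrite geq_max => /andP[/h1 ? /h2 ?].
apply: le_lt_trans (nr_ReIm _) _; rewrite !raddfB /=; lra.
Qed.

(** A net makes every ultrafilter containing the closure Cauchy: the
    ultrafilter must contain one of the finitely many small balls that cover
    the set. Completeness then gives the limit. *)
Lemma precompact_of_net (Z : completeNormedModType R[i]) (A : set Z) :
  (forall e : R, 0 < e -> exists s : seq Z, forall x, A x ->
     exists2 y, y \in s & nr (x - y) < e) ->
  precompact A.
Proof.
move=> net; rewrite precompactE compact_ultra /= => F UF FA.
have FF : ProperFilter F := ultra_proper.
suff : cauchy_ex F.
  move=> /cauchy_exP /cauchy_cvg Fl; exists (lim F); split => //.
  have : closed (closure A) by exact: closed_closure.
  by apply=> B /Fl FB; apply: (@filter_ex _ F); apply: filterI.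
move=> _ /gt0_complexP[d d0 ->]; have d2 : 0 < d / 2 by lra.
have [s hs] := net _ d2.
have : F [set x | exists2 y, y \in s & nr (x - y) < d].
  apply: filterS FA => x /(_ (ball x (d / 2)%:C)) [].
    by apply: nbhsx_ballx; rewrite ltcR.
  move=> a [/hs[y ys ay]]; rewrite -ball_normE /= nr_ltP => xa.
  by exists y => //; apply: le_lt_trans (nr_tri _ a _) _; lra.
elim: s {hs} => [|y s IH] Fs.
  exfalso; apply: (@filter_not_empty _ F); apply: filterS Fs.
  by move=> x [].
have [Fy|Fy] := in_ultra_setVsetC (ball y d%:C) UF; first by exists y.
apply: IH; apply: filterS (filterI Fs Fy) => x [[z]].
rewrite inE => /predU1P[-> xy|zs xz _]; last by exists z.
by rewrite -ball_normE /= nr_ltP nrC.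
Qed.

End Limits.

(** * The completion of a seminormed space *)

Record seminorm (R : realType) (X : lmodType R[i]) := Seminorm {
  sn :> X -> R;
  snD : forall x y, sn (x + y) <= sn x + sn y;
  snZ : forall (c : R[i]) x, sn (c *: x) = nr c * sn x }.

Section SeminormTheory.
Context {R : realType} {X : lmodType R[i]} (q : seminorm X).

Lemma sn0 : q 0 = 0.
Proof. by rewrite -(scale0r 0) snZ nr0 mul0r. Qed.

Lemma snN x : q (- x) = q x.
Proof. by rewrite -scaleN1r snZ nrN nr1 mul1r. Qed.

Lemma sn_ge0 x : 0 <= q x.
Proof. by have := snD q x (- x); rewrite subrr sn0 snN; lra. Qed.

Lemma snC x y : q (x - y) = q (y - x).
Proof. by rewrite -(snN (x - y)) opprB. Qed.

Lemma sn_tri x y z : q (x - z) <= q (x - y) + q (y - z).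
Proof. by rewrite -(subrKA y) snD. Qed.

Lemma sn_sum (I : Type) (r : seq I) (P : pred I) (F : I -> X) :
  q (\sum_(i <- r | P i) F i) <= \sum_(i <- r | P i) q (F i).
Proof.
elim/big_ind2 : _ => //; first by rewrite sn0.
by move=> a b c d ab cd; apply: le_trans (snD _ _ _) (lerD ab cd).
Qed.

Lemma sn_dist x y : `|q x - q y| <= q (x - y).
Proof.
rewrite ler_norml; have := snD q (x - y) y; have := snD q (y - x) x.
by rewrite !subrK (snC y); lra.
Qed.

End SeminormTheory.

Section Completion.
Context {R : realType} {X : lmodType R[i]} (q : seminorm X).

Definition qcauchy : {pred nat -> X} := [pred u | `[< forall e : R, 0 < e ->
  exists N, forall n m, (N <= n)%N -> (N <= m)%N -> q (u n - u m) < e >]].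

Lemma qcauchy_submod : submod_closed qcauchy.
Proof.
split=> [|c u v /asboolP uc /asboolP vc].
  by apply/asboolP => e e0; exists 0%N => n m _ _; rewrite subrr sn0.
apply/asboolP => e e0; have c0 : 0 < nr c + 1 by have := nr_ge0 c; lra.
have e2 : 0 < e / 2 by lra.
have [|N1 h1] := uc (e / 2 / (nr c + 1)); first by rewrite divr_gt0.
have [N2 h2] := vc _ e2.
exists (maxn N1 N2) => n m; rewrite !geq_max => /andP[n1 n2] /andP[m1 m2].
have := h1 _ _ n1 m1; rewrite ltr_pdivlMr// => h.
rewrite [X in q X](_ : _ = c *: (u n - u m) + (v n - v m)).
  apply: le_lt_trans (snD q _ _) _; rewrite snZ.
  have := h2 _ _ n2 m2; have := sn_ge0 q (u n - u m); have := nr_ge0 c; nra.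
by rewrite scalerBr opprD addrACA.
Qed.

HB.instance Definition _ :=
  GRing.isSubmodClosed.Build R[i] (nat -> X) qcauchy qcauchy_submod.

Record cseq := CSeq { cval :> nat -> X; cvalP : cval \in qcauchy }.

HB.instance Definition _ := [isSub for cval].
HB.instance Definition _ := [Choice of cseq by <:].
HB.instance Definition _ := [SubChoice_isSubLmodule of cseq by <:].

Definition qnull : {pred cseq} := [pred u | `[< forall e : R, 0 < e ->
  exists N, forall n, (N <= n)%N -> q (cval u n) < e >]].

Lemma qnull_zmod : zmod_closed qnull.
Proof.
split=> [|u v /asboolP uc /asboolP vc].
  by apply/asboolP => e e0; exists 0%N => n _; rewrite [cval _ _]/= sn0.
apply/asboolP => e e0; have e2 : 0 < e / 2 by lra.
have [N1 h1] := uc _ e2; have [N2 h2] := vc _ e2.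
exists (maxn N1 N2) => n; rewrite !geq_max => /andP[/h1 n1 /h2 n2].
rewrite [X in q X](_ : _ = u n - v n)//.
by apply: le_lt_trans (snD q _ _) _; rewrite snN; lra.
Qed.

HB.instance Definition _ := GRing.isZmodClosed.Build cseq qnull qnull_zmod.

Definition completion := Quotient.quot qnull.
HB.instance Definition _ := GRing.Zmodule.on completion.

Implicit Types (u v : cseq) (z w : completion).

Definition cls (u : cseq) : completion := \pi_(Quotient.quot qnull) u.

Lemma clsD u v : cls (u + v) = cls u + cls v.
Proof. exact: raddfD. Qed.

Lemma clsB u v : cls (u - v) = cls u - cls v.
Proof. exact: raddfB. Qed.

Lemma clsP z : exists u, z = cls u.
Proof. by exists (repr z); rewrite /cls reprK. Qed.

Lemma cls_eqP u v : cls u = cls v <->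
  (forall e : R, 0 < e -> exists N, forall n, (N <= n)%N -> q (u n - v n) < e).
Proof.
split=> [/eqP|uv].
  by rewrite /cls -(@Quotient.idealrBE _ qnull) => /asboolP.
apply/eqP; rewrite /cls -(@Quotient.idealrBE _ qnull); exact/asboolP.
Qed.

(** Scalar multiplication is defined on a chosen representative; cls_scale
    shows that the choice does not matter. *)
Definition cscale (c : R[i]) (z : completion) : completion := cls (c *: repr z).

Lemma cls_scale c u : cls (c *: u) = cscale c (cls u).
Proof.
apply/cls_eqP => e e0; have c0 : 0 < nr c + 1 by have := nr_ge0 c; lra.
have : cls u = cls (repr (cls u)) by rewrite {2}/cls reprK.
move=> /cls_eqP/(_ (e / (nr c + 1))) []; first by rewrite divr_gt0.
move=> N hN; exists N => n /hN; rewrite ltr_pdivlMr//.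
rewrite [X in _ -> q X < _](_ : _ = c *: (u n - repr (cls u) n)).
  by rewrite snZ; have := sn_ge0 q (u n - repr (cls u) n); have := nr_ge0 c; nra.
by rewrite scalerBr.
Qed.

Lemma cscaleA a b z : cscale a (cscale b z) = cscale (a * b) z.
Proof. by have [u ->] := clsP z; rewrite -!cls_scale scalerA. Qed.

Lemma cscale1 : left_id 1 cscale.
Proof. by move=> z; have [u ->] := clsP z; rewrite -cls_scale scale1r. Qed.

Lemma cscaleDr : right_distributive cscale +%R.
Proof.
move=> c z w; have [u ->] := clsP z; have [v ->] := clsP w.
by rewrite -clsD -!cls_scale -clsD scalerDr.
Qed.

Lemma cscaleDl z : {morph cscale^~ z : a b / a + b}.
Proof.
by move=> a b; have [u ->] := clsP z; rewrite -!cls_scale -clsD scalerDl.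
Qed.

HB.instance Definition _ := GRing.Zmodule_isLmodule.Build R[i] completion
  cscaleA cscale1 cscaleDr cscaleDl.

Lemma clsZ (c : R[i]) u : cls (c *: u) = c *: cls u.
Proof. exact: cls_scale. Qed.

Definition cnormR (z : completion) : R := lim ((fun n => q (repr z n)) @ \oo).

Lemma cnormP u (e : R) : 0 < e ->
  exists N, forall n, (N <= n)%N -> `|q (u n) - cnormR (cls u)| < e.
Proof.
move=> e0; have e2 : 0 < e / 2 by lra.
have : (fun n => q (repr (cls u) n)) @ \oo --> cnormR (cls u).
  apply: cauchy_cvg; apply: cauchy_exP => d d0.
  have /asboolP/(_ _ d0)[N hN] := cvalP (repr (cls u)).
  exists (q (repr (cls u) N)); exists N => // n /= Nn.
  rewrite -ball_normE /=; apply: le_lt_trans (sn_dist _ _ _) _; exact: hN.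
move=> /cvgrPdist_lt/(_ _ e2) [N1 _ h1].
have : cls u = cls (repr (cls u)) by rewrite {2}/cls reprK.
move=> /cls_eqP/(_ _ e2) [N2 h2].
exists (maxn N1 N2) => n; rewrite geq_max => /andP[/h1 /= + /h2 n2]; rewrite distrC => n1.
have := sn_dist q (u n) (repr (cls u) n).
have := ler_distD (q (repr (cls u) n)) (q (u n)) (cnormR (cls u)).
lra.
Qed.

Lemma cnorm_le u (b : R) N :
  (forall n, (N <= n)%N -> q (u n) <= b) -> cnormR (cls u) <= b.
Proof.
move=> ub; apply/ler_addgt0Pr => e e0; have [M hM] := cnormP u e0.
have := hM (maxn M N) (leq_maxl _ _); have := ub (maxn M N) (leq_maxr _ _).
by rewrite ltr_norml => ? /andP[? ?]; lra.
Qed.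

Lemma cnormRD z w : cnormR (z + w) <= cnormR z + cnormR w.
Proof.
have [u ->] := clsP z; have [v ->] := clsP w; rewrite -clsD.
apply/ler_addgt0Pr => e e0; have e2 : 0 < e / 2 by lra.
have [N1 h1] := cnormP u e2; have [N2 h2] := cnormP v e2.
apply: (@cnorm_le _ _ (maxn N1 N2)) => n.
rewrite geq_max => /andP[/h1 + /h2].
rewrite !ltr_norml => /andP[? ?] /andP[? ?].
by have := snD q (u n) (v n); rewrite [X in q X](_ : _ = (u + v) n)//; lra.
Qed.

Lemma cnormRZ (c : R[i]) z : cnormR (c *: z) = nr c * cnormR z.
Proof.
have [u ->] := clsP z; rewrite -clsZ.
have c0 : 0 < nr c + 1 by have := nr_ge0 c; lra.
apply/eqP; rewrite -subr_eq0 -normr_le0; apply/ler_addgt0Pr => e e0.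
have e2 : 0 < e / 2 by lra.
have [|N1 h1] := @cnormP u (e / 2 / (nr c + 1)); first by rewrite divr_gt0.
have [N2 h2] := cnormP (c *: u) e2.
have := h1 _ (leq_maxl N1 N2); rewrite ltr_pdivlMr// => B.
have := h2 _ (leq_maxr N1 N2); move: B.
set n := maxn _ _ => B; rewrite [X in q X](_ : _ = c *: u n)// snZ.
have := nr_ge0 c; have := normr_ge0 (q (u n) - cnormR (cls u)) => a b.
move=> A; rewrite add0r.
have -> : cnormR (cls (c *: u)) - nr c * cnormR (cls u) =
  - (nr c * q (u n) - cnormR (cls (c *: u))) + nr c * (q (u n) - cnormR (cls u)).
  by ring.
apply: le_trans (ler_normD _ _) _; rewrite normrN normrM (ger0_norm b).
nra.
Qed.

Lemma cnormR_eq0 z : cnormR z = 0 -> z = 0.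
Proof.
have [u ->] := clsP z => u0.
have -> : 0 = cls 0 by rewrite -(subrr (cls 0)) -clsB subrr.
apply/cls_eqP => e e0; have [N hN] := cnormP u e0.
exists N => n /hN; by rewrite u0 !subr0 ger0_norm ?sn_ge0.
Qed.

Definition cnorm (z : completion) : R[i] := (cnormR z)%:C.

Lemma cnormD z w : cnorm (z + w) <= cnorm z + cnorm w.
Proof. by rewrite /cnorm -rmorphD lecR cnormRD. Qed.

Lemma cnormZ (c : R[i]) z : cnorm (c *: z) = `|c| * cnorm z.
Proof. by rewrite /cnorm cnormRZ rmorphM /= normE. Qed.

Lemma cnorm_eq0 z : cnorm z = 0 -> z = 0.
Proof. by case=> /cnormR_eq0. Qed.

HB.instance Definition _ := Lmodule_isNormed.Build R[i] completion
  cnormD cnormZ cnorm_eq0.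

Lemma nr_completion (z : completion) : nr z = cnormR z.
Proof. by rewrite /nr /Num.norm /=. Qed.

Lemma qcauchy_cst (x : X) : (fun=> x) \in qcauchy.
Proof. by apply/asboolP => e e0; exists 0%N => n m _ _; rewrite subrr sn0. Qed.

Definition to_completion (x : X) : completion := cls (CSeq (qcauchy_cst x)).

Lemma to_completion_linear : linear to_completion.
Proof.
move=> c x y; rewrite /to_completion -clsZ -clsD; congr cls.
exact/val_inj.
Qed.

HB.instance Definition _ := GRing.isLinear.Build R[i] X completion _
  to_completion to_completion_linear.

Lemma nr_to_completion x : nr (to_completion x) = q x.
Proof.
rewrite nr_completion; apply/eqP; rewrite -subr_eq0 -normr_le0.
apply/ler_addgt0Pr => e e0; have [N hN] := cnormP (CSeq (qcauchy_cst x)) e0.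
by have := hN N (leqnn _); rewrite /= distrC; lra.
Qed.

Lemma to_completion_dense z (e : R) : 0 < e -> exists x, nr (to_completion x - z) < e.
Proof.
move=> e0; have e2 : 0 < e / 2 by lra.
have [u ->] := clsP z; have /asboolP/(_ _ e2)[N hN] := cvalP u.
exists (u N); rewrite nr_completion -clsB.
apply: (@le_lt_trans _ _ (e / 2)); last by lra.
apply: (@cnorm_le _ _ N) => n Nn; apply: ltW; exact: hN.
Qed.

(** Points of the dense subspace that follow a Cauchy filter at distance
    tending to 0 form a Cauchy sequence, and its class is the limit of the
    filter. *)
Lemma completion_complete (F : set_system completion) :
  ProperFilter F -> cauchy F -> cvg F.
Proof.
move=> FF /cauchyP Fc.
have [r r0 small] : exists2 r : nat -> R, forall n, 0 < r n & forall e : R, 0 < e ->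
    exists N, forall n, (N <= n)%N -> r n < e.
  exists (fun n => n.+1%:R^-1) => [n|e e0]; first by rewrite invr_gt0 ltr0n.
  by have := near_infty_natSinv_lt (PosNum e0) => -[N _ hN]; exists N => n /hN.
have /choice[x hx] : forall n : nat, exists x : X,
    F (ball (to_completion x) (r n *+ 2)%:C).
  move=> n; have [|z Fz] := Fc (r n)%:C; first by rewrite ltcR.
  have [x xz] := to_completion_dense z (r0 n); exists x.
  apply: filterS Fz => w; rewrite -!ball_normE /= !nr_ltP mulr2n => zw.
  by apply: le_lt_trans (nr_tri _ z _) _; apply: ltrD.
have xx n m : q (x n - x m) < r n *+ 2 + r m *+ 2.
  have [w []] := @filter_ex _ F _ _ (filterI (hx n) (hx m)).
  rewrite -!ball_normE /= !nr_ltP => h1 h2.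
  rewrite -nr_to_completion linearB /=; apply: le_lt_trans (nr_tri _ w _) _.
  by rewrite (nrC w) ltrD.
have xc : x \in qcauchy.
  apply/asboolP => e e0; have [|N hN] := small (e / 4); first by lra.
  exists N => n m /hN h1 /hN h2; apply: lt_trans (xx n m) _.
  by rewrite (mulr2n (r n)) (mulr2n (r _)); lra.
apply/cvg_ex; exists (cls (CSeq xc)); apply/cvgrPdist_lt => _ /gt0_complexP[e e0 ->].
have [|N hN] := small (e / 8); first by lra.
have := hN N (leqnn _) => N8.
near=> w; rewrite nr_ltP.
apply: le_lt_trans (nr_tri _ (to_completion (x N)) _) _.
have : ball (to_completion (x N)) (r N *+ 2)%:C w by near: w; exact: hx.
rewrite -ball_normE /= nr_ltP.
suff : nr (cls (CSeq xc) - to_completion (x N)) <= e / 2 by rewrite (mulr2n (r N)); lra.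
rewrite nr_completion -clsB; apply: (@cnorm_le _ _ N) => n /hN h.
by apply: ltW; apply: lt_trans (xx n N) _; rewrite (mulr2n (r n)) (mulr2n (r _)); lra.
Unshelve. all: by end_near. Qed.

HB.instance Definition _ := Uniform_isComplete.Build completion completion_complete.

End Completion.

(** * Entire functions of one complex variable *)

Section OneVariable.
Context {R : realType} {Y : normedModType R[i]}.
Implicit Types (F G H : R[i] -> Y) (z w : R[i]).

(** A second order Taylor expansion with cubic remainder at the point z. It is
    the only local information on an analytic function that the maximum
    principle below uses, and unlike power series it is immediately stable
    under division by a nonvanishing coordinate. *)
Definition jet2 G z : Prop := exists c0 c1 c2 : Y, exists C r : R,
  [/\ 0 <= C, 0 < r & forall w, nr w < r ->
    nr (G (z + w) - (c0 + w *: c1 + w ^+ 2 *: c2)) <= C * nr w ^+ 3].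

Lemma sconv_bounded (u : nat -> Y) l : sconv u l -> exists2 B, 0 <= B & forall n, nr (u n) <= B.
Proof.
move=> ul; have [|N hN] := @sconv_nr_lt _ _ u l (nr l + 1) ul; first by lra.
have s0 : 0 <= \sum_(i < N) nr (u i) by apply: sumr_ge0 => i _; apply: nr_ge0.
exists (\sum_(i < N) nr (u i) + (nr l + 1)).
  by have := nr_ge0 l; lra.
move=> n; have [/hN|nN] := leqP N n; first by lra.
rewrite (bigD1 (Ordinal nN))//=.
have : 0 <= \sum_(i < N | i != Ordinal nN) nr (u i).
  by apply: sumr_ge0 => i _; apply: nr_ge0.
by have := nr_ge0 l; lra.
Qed.

Lemma sconv_shift (V : normedZmodType R[i]) (u : nat -> V) l :
  sconv (fun n => u n.+1) l <-> sconv u l.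
Proof.
split=> ul e /ul[N hN]; last by exists N => n Nn; apply: hN; rewrite leqW.
by exists N.+1 => -[//|n] /hN.
Qed.

Lemma series_terms_bounded (a : nat -> Y) l :
  sconv (fun n => \sum_(k < n) a k) l -> exists2 B, 0 <= B & forall n, nr (a n) <= B.
Proof.
move=> al; have [B B0 hB] := sconv_bounded al; exists (B + B); first by lra.
move=> n; have -> : a n = \sum_(k < n.+1) a k - \sum_(k < n) a k.
  by rewrite big_ord_recr /= addrAC subrr add0r.
by apply: le_trans (nrB _ _) (lerD _ _); apply: hB.
Qed.

Lemma geometric_le2 (s : R) n : 0 <= s -> s <= 1/2 -> \sum_(i < n) s ^+ i <= 2.
Proof.
move=> s0 s1; have := subrX1 s n; have := exprn_ge0 n s0.
have : 0 <= \sum_(i < n) s ^+ i by apply: sumr_ge0 => i _; apply: exprn_ge0.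
nra.
Qed.

(** The terms are bounded by some B at radius t, half the radius of
    convergence, so that for nr w < t / 2 the tail from order 3 on is
    dominated by a geometric series of ratio at most 1 / 2. *)
Lemma power_series_jet2 G z (a : nat -> Y) (r : R) : 0 < r ->
  (forall w, nr w < r -> sconv (fun n => \sum_(k < n) w ^+ k *: a k) (G (z + w))) ->
  jet2 G z.
Proof.
move=> r0 Ga; have [t t0 tr2] : exists2 t : R, 0 < t & 2 * t = r by exists (r / 2); lra.
have ntE : nr t%:C = t by rewrite nr_real gtr0_norm.
have tr : nr t%:C < r by rewrite ntE; lra.
have [B B0 hB] := @series_terms_bounded (fun k => t%:C ^+ k *: a k) _ (Ga _ tr).
exists (a 0), (a 1), (a 2), (2 * B / t ^+ 3), (t / 2).
split => [||w wt]; [|lra|].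
  by rewrite !mulr_ge0// invr_ge0 exprn_ge0// ltW.
have wr : nr w < r by lra.
have wt2 : nr w / t <= 1 / 2 by rewrite ler_pdivrMr//; lra.
have wt0 : 0 <= nr w / t by rewrite divr_ge0 ?nr_ge0// ltW.
have := sconvB (Ga w wr) (sconv_cst (a 0 + w *: a 1 + w ^+ 2 *: a 2)).
move=> /(@sconv_nr_le _ _ _ _ _ 3); apply => n n3.
rewrite -(subnKC n3) big_split_ord /= !big_ord_recl big_ord0 /= /bump /= !add1n.
rewrite expr0 scale1r expr1 addr0 addrA (addrAC _ (\sum_(_ < _) _)) subrr add0r.
apply: le_trans (nr_sum _ _ _) _.
have -> : 2 * B / t ^+ 3 * nr w ^+ 3 = (B * (nr w / t) ^+ 3) * 2.
  by rewrite expr_div_n; ring.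
apply: (@le_trans _ _ (\sum_(i < n - 3) (B * (nr w / t) ^+ 3) * (nr w / t) ^+ i)).
  apply: ler_sum => i _; rewrite nrZ nrX -mulrA -exprD.
  have := hB (3 + i)%N; rewrite nrZ nrX ntE => h.
  rewrite expr_div_n mulrCA; apply: ler_wpM2l; first by rewrite exprn_ge0// nr_ge0.
  by rewrite ler_pdivlMr ?exprn_gt0// mulrC.
rewrite -mulr_sumr; apply: ler_wpM2l; first by rewrite mulr_ge0// exprn_ge0.
exact: geometric_le2.
Qed.

Lemma jet2_ext G H z (r : R) : 0 < r -> (forall w, nr w < r -> G (z + w) = H (z + w)) ->
  jet2 G z -> jet2 H z.
Proof.
move=> r0 GH [c0 [c1 [c2 [C [s [C0 s0 h]]]]]].
exists c0, c1, c2, C, (Num.min r s); split => //; first by rewrite lt_min r0.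
by move=> w; rewrite lt_min => /andP[/GH <- /h].
Qed.

Lemma subr_ACA (V : zmodType) (a b c d : V) : a - b - (c - d) = a - c - (b - d).
Proof. by rewrite !opprB addrACA [RHS]addrACA (addrC (- b)). Qed.

Lemma jet2B G H z : jet2 G z -> jet2 H z -> jet2 (fun z => G z - H z) z.
Proof.
move=> [c0 [c1 [c2 [C [s [C0 s0 h]]]]]] [d0 [d1 [d2 [D [r [D0 r0 k]]]]]].
exists (c0 - d0), (c1 - d1), (c2 - d2), (C + D), (Num.min s r).
split; [by rewrite addr_ge0|by rewrite lt_min s0|move=> w].
rewrite lt_min => /andP[/h hw /k kw].
rewrite !scalerBr (addrACA c0) (addrACA (c0 + _)) -!opprD subr_ACA.
by apply: le_trans (nrB _ _) _; rewrite mulrDl lerD.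
Qed.

Lemma jet2_cst (c : Y) z : jet2 (fun=> c) z.
Proof.
exists c, 0, 0, 0, 1; split => // w _.
by rewrite !scaler0 !addr0 subrr nr0 mul0r.
Qed.

(** The coefficients d0, d1, d2 are those of the formal quotient of the
    expansion of G by z + w. *)
Lemma jet2_divz G z : z != 0 -> jet2 G z -> jet2 (fun z => z^-1 *: G z) z.
Proof.
move=> z0 [c0 [c1 [c2 [C [s [C0 s0 h]]]]]].
have nz0 : 0 < nr z by rewrite lt_neqAle nr_ge0 andbT eq_sym; apply: contra_neq z0 => /nr0_eq0.
pose d0 := z^-1 *: c0; pose d1 := z^-1 *: (c1 - d0); pose d2 := z^-1 *: (c2 - d1).
exists d0, d1, d2, ((C + nr d2) * (2 / nr z)), (Num.min s (nr z / 2)).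
split => [||w].
- by rewrite mulr_ge0 ?addr_ge0 ?nr_ge0// divr_ge0// ltW.
- by rewrite lt_min s0; lra.
rewrite lt_min => /andP[ws wz].
have zw : nr z / 2 <= nr (z + w) by have := nrB (z + w) w; rewrite addrK; lra.
have zw0 : z + w != 0.
  by apply/eqP => zw1; move: zw; rewrite zw1 nr0; lra.
have e0 : z *: d0 = c0 by rewrite scalerA mulfV// scale1r.
have e1 : z *: d1 + d0 = c1 by rewrite scalerA mulfV// scale1r subrK.
have e2 : z *: d2 + d1 = c2 by rewrite scalerA mulfV// scale1r subrK.
clearbody d2 d1 d0.
have -> : (z + w)^-1 *: G (z + w) - (d0 + w *: d1 + w ^+ 2 *: d2) =
   (z + w)^-1 *: ((G (z + w) - (c0 + w *: c1 + w ^+ 2 *: c2)) - w ^+ 3 *: d2).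
  apply: (@scalerI _ _ (z + w)) => //; rewrite scalerBr !scalerA mulfV// !scale1r.
  rewrite -[RHS]addrA -opprD; congr (_ - _).
  rewrite -e0 -e1 -e2 scalerDl !scalerDr !scalerA -exprS -[w * w]expr2.
  rewrite (mulrC w z) (mulrC (w ^+ 2) z) -!addrA; congr (_ + _).
  by congr (_ + _); rewrite addrCA.
rewrite nrZ nrV; have H := h w ws.
have : nr (G (z + w) - (c0 + w *: c1 + w ^+ 2 *: c2) - w ^+ 3 *: d2) <=
    (C + nr d2) * nr w ^+ 3.
  by apply: le_trans (nrB _ _) _; rewrite nrZ nrX; lra.
move=> K; have -> : (C + nr d2) * (2 / nr z) * nr w ^+ 3 =
  (2 / nr z) * ((C + nr d2) * nr w ^+ 3) by ring.
apply: ler_pM => //; rewrite ?invr_ge0 ?nr_ge0//.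
rewrite -[2 / nr z]invrK invf_div lef_pV2 ?posrE//; lra.
Qed.

Lemma jet2_continuous G z (e : R) : jet2 G z -> 0 < e ->
  exists2 d : R, 0 < d & forall w, nr w < d -> nr (G (z + w) - G z) < e.
Proof.
move=> [c0 [c1 [c2 [C [s [C0 s0 h]]]]]] e0.
have Gz : G z = c0.
  have := h 0; rewrite nr0 addr0 !scale0r expr0n /= scale0r !addr0 expr0n mulr0.
  move=> /(_ s0) g; apply/eqP; rewrite -subr_eq0; apply/eqP/nr0_eq0.
  by apply/eqP; rewrite eq_le g nr_ge0.
pose K := nr c1 + nr c2 + C + 1.
have K0 : 0 < K by have := nr_ge0 c1; have := nr_ge0 c2; rewrite /K; lra.
exists (Num.min s (Num.min 1 (e / K))); first by rewrite !lt_min s0 ltr01 divr_gt0.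
move=> w; rewrite !lt_min => /and3P[/h hw w1 we]; rewrite Gz.
rewrite ltr_pdivlMr// in we.
have -> : G (z + w) - c0 = G (z + w) - (c0 + w *: c1 + w ^+ 2 *: c2) + (w *: c1 + w ^+ 2 *: c2).
  by rewrite -(addrA c0) opprD (addrA (G _)) subrK.
apply: le_lt_trans (nrD _ _) _.
have := nrD (w *: c1) (w ^+ 2 *: c2); rewrite !nrZ nrX => hD.
have := nr_ge0 w => nw0.
have w2 : nr w ^+ 2 <= nr w by rewrite expr2; nra.
have w3 : nr w ^+ 3 <= nr w by rewrite exprS; have := sqr_ge0 (nr w); nra.
have := ler_wpM2l C0 w3; have := ler_wpM2r (nr_ge0 c2) w2; rewrite /K in we.
lra.
Qed.

(** Squares are used instead of discs because they are products of intervals,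
    hence compact; the radii of the inscribed and circumscribed discs differ
    by a constant factor, which is harmless for entire functions. *)
Definition square (rho : R) z : Prop := `|complex.Re z| <= rho /\ `|complex.Im z| <= rho.

(** If the norm of G exceeded M inside the square, then for a small e > 0 the
    function nr (G z) + e * |z|^2 would have an interior maximum z0. The
    average over the four points z0 + w with w^4 = t^4 kills the terms of
    order 1 and 2 of the expansion of G, so the average of nr (G z) is at
    least nr (G z0) - C * t^3, whereas the average of e * |z|^2 grows by
    exactly e * t^2: a contradiction when t is small. *)
Lemma max_principle G (rho M : R) : 0 < rho -> (forall z, jet2 G z) ->
  (forall z, square rho z -> rho <= nr z -> nr (G z) <= M) ->
  forall z, square rho z -> nr (G z) <= M.
Proof.
move=> rho0 Gj GM z1 [z1r z1i]; rewrite leNgt; apply/negP => Mz.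
pose e := (nr (G z1) - M) / (3 * rho ^+ 2).
have rr : 0 < rho ^+ 2 by rewrite exprn_gt0.
have e0 : 0 < e by rewrite divr_gt0 ?mulr_gt0// subr_gt0.
have eE : e * (3 * rho ^+ 2) = nr (G z1) - M.
  by rewrite /e divfK//; lra.
pose u (p : R * R) := nr (G (p.1 +i* p.2)) + e * (p.1 ^+ 2 + p.2 ^+ 2).
pose Q := `[(- rho), rho]%classic `*` `[(- rho), rho]%classic : set (R * R).
have QP p : Q p <-> square rho (p.1 +i* p.2).
  by rewrite /Q /square /= !in_itv /= -!ler_norml.
have Q0 : Q !=set0 by exists (complex.Re z1, complex.Im z1); apply/QP; split.
have cQ : compact Q by apply: compact_setX; apply: segment_compact.
have cu : continuous u.
  move=> -[x y]; apply: cvgD.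
    apply/cvgrPdist_lt => d d0.
    have [t t0 ht] := jet2_continuous (Gj (x +i* y)) d0.
    have t2 : 0 < t / 2 by lra.
    exists (ball x (t / 2), ball y (t / 2)).
      by split; apply: nbhsx_ballx.
    case=> x' y' [/=]; rewrite -!ball_normE /= => xx' yy'.
    have := ht ((x' - x) +i* (y' - y)).
    rewrite [X in G X - _](_ : _ = x' +i* y'); last by congr (_ +i* _); lra.
    move=> hG; apply: le_lt_trans (hG _).
      rewrite ler_norml.
      have := nrD (G (x' +i* y')) (G (x +i* y) - G (x' +i* y')).
      have := nrD (G (x +i* y)) (G (x' +i* y') - G (x +i* y)).
      by rewrite !subrKC (nrC (G (x +i* y))) => ? ?; apply/andP; split; lra.
    apply: le_lt_trans (nr_ReIm _) _; rewrite /= (distrC x') (distrC y'); lra.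
  apply: cvgM; first exact: cvg_cst.
  by apply: cvgD; apply: cvgM; (exact: cvg_fst || exact: cvg_snd).
have [[x y] /set_mem/QP /= [x0 y0] max] := compact_EVT_max Q0 cQ (continuous_subspaceT cu).
have uz1 : u (complex.Re z1, complex.Im z1) <= u (x, y).
  by apply: max; apply/mem_set/QP; split.
have eqz1 : complex.Re z1 +i* complex.Im z1 = z1 by case: (z1).
have sq a b : `|a| <= b -> a ^+ 2 <= b ^+ 2 :> R.
  by move=> ab; rewrite -(real_normK (num_real a)) lerXn2r ?nnegrE// (le_trans _ ab).
(* Near the boundary u is at most M + 2 * e * rho ^+ 2, below its value at z1. *)
have z0lt : nr (x +i* y) < rho.
  rewrite ltNge; apply/negP => /(GM (x +i* y) (conj x0 y0)) Gz0.
  move: uz1; rewrite /u /= eqz1.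
  have := sq _ _ x0; have := sq _ _ y0.
  have := sqr_ge0 (complex.Re z1); have := sqr_ge0 (complex.Im z1) => a b c d.
  have : 0 <= e * (complex.Re z1 ^+ 2 + complex.Im z1 ^+ 2).
    by rewrite mulr_ge0 ?addr_ge0// ltW.
  have : e * (x ^+ 2 + y ^+ 2) <= e * (rho ^+ 2 + rho ^+ 2).
    by rewrite ler_pM2l// lerD.
  have : 0 < e * rho ^+ 2 by rewrite mulr_gt0.
  lra.
(* From here on only the maximality of u at an interior point matters. *)
clearbody e; clear z1 z1r z1i Mz GM M uz1 eqz1 eE rr sq Q0 cQ cu x0 y0.
have := Re_le_nr (x +i* y); have := Im_le_nr (x +i* y); rewrite /= => yl xl.
have [c0 [c1 [c2 [C [s [C0 s0 h]]]]]] := Gj (x +i* y).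
(* With C * t < e the cubic errors lose against the growth e * t ^+ 2. *)
have [t [t0 ts tx tC]] : exists t : R, [/\ 0 < t, t < s, t <= rho - nr (x +i* y) & C * t < e].
  have eC : 0 < e / (C + 1) by rewrite divr_gt0//; lra.
  have m0 : 0 < Num.min s (Num.min (rho - nr (x +i* y)) (e / (C + 1))).
    by rewrite !lt_min s0 eC andbT /=; lra.
  have : Num.min s (Num.min (rho - nr (x +i* y)) (e / (C + 1))) <=
         Num.min s (Num.min (rho - nr (x +i* y)) (e / (C + 1))) by [].
  set m := Num.min _ _ in m0 *; rewrite {2}/m !le_min => /and3P[ms mr me].
  rewrite ler_pdivlMr// in me; last by lra.
  exists (m / 2); split; nra.
pose P w := c0 + w *: c1 + w ^+ 2 *: c2.
have PN w : P w + P (- w) = (c0 + c0) + (w ^+ 2 + w ^+ 2) *: c2.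
  by rewrite /P sqrrN scaleNr addrACA (addrACA c0) subrr addr0 scalerDl.
have pt w : nr w = t -> square rho (x +i* y + w) ->
    nr (G (x +i* y + w)) <= u (x, y)
      - e * ((x + complex.Re w) ^+ 2 + (y + complex.Im w) ^+ 2) /\
    nr (G (x +i* y + w) - P w) <= C * t ^+ 3.
  case: w => a b wt wQ; split; last by rewrite -wt; apply: h; rewrite wt.
  by have := max _ (mem_set ((QP (x + a, y + b)).2 wQ)); rewrite /u /=; lra.
have nt : nr t%:C = t by rewrite nr_real gtr0_norm.
have nit : nr (t *i) = t by rewrite /nr normc_def /= expr0n add0r sqrtr_sqr gtr0_norm.
have inQ a b : `|a| <= t -> `|b| <= t -> square rho (x +i* y + a +i* b).
  move=> at' bt; split => /=; apply: le_trans (ler_normD _ _) _; lra.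
have [|p1 q1] := pt t%:C nt; first by apply: inQ; rewrite ?normr0 ?gtr0_norm//; lra.
have [||p2 q2] := pt (- t%:C); [by rewrite nrN| |].
  by rewrite -complexr0; apply: inQ; rewrite ?oppr0 ?normrN ?normr0 ?gtr0_norm//; lra.
have [|p3 q3] := pt (t *i) nit; first by apply: inQ; rewrite ?normr0 ?gtr0_norm//; lra.
have [||p4 q4] := pt (- (t *i)); [by rewrite nrN| |].
  by apply: inQ; rewrite ?oppr0 ?normrN ?normr0 ?gtr0_norm//; lra.
have Gz0 : nr (G (x +i* y)) = nr c0.
  have := h 0; rewrite nr0 addr0 !scale0r expr0n /= scale0r !addr0 expr0n mulr0.
  move=> /(_ s0) g; congr nr; apply/eqP; rewrite -subr_eq0; apply/eqP/nr0_eq0.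
  by apply/eqP; rewrite eq_le g nr_ge0.
have Psum : P t%:C + P (- t%:C) + (P (t *i) + P (- (t *i))) = c0 *+ 4.
  rewrite !PN; have -> : (t *i) ^+ 2 = - (t%:C ^+ 2) :> R[i].
    by rewrite !expr2; simpc.
  by rewrite -opprD scaleNr addrACA subrr addr0 -!mulr2n -mulrnA.
have nP w : nr (P w) <= nr (G (x +i* y + w)) + nr (G (x +i* y + w) - P w).
  by have := nrB (G (x +i* y + w)) (G (x +i* y + w) - P w); rewrite opprB addrC subrK.
have n4 : nr (c0 *+ 4) = 4 * nr c0.
  by rewrite /nr normrMn raddfMn /= mulr_natl.
have := nrD (P t%:C + P (- t%:C)) (P (t *i) + P (- (t *i))).
have := nrD (P t%:C) (P (- t%:C)); have := nrD (P (t *i)) (P (- (t *i))).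
rewrite Psum n4.
have := nP t%:C; have := nP (- t%:C); have := nP (t *i); have := nP (- (t *i)).
have Ct : C * t ^+ 3 < e * t ^+ 2.
  by rewrite exprS mulrA ltr_pM2r// exprn_gt0.
move: p1 p2 p3 p4; rewrite /u /= Gz0 => p1 p2 p3 p4.
move: q1 q2 q3 q4; lra.
Qed.

(** The quotient (G - G 0) / z is bounded through the maximum principle, its
    size being controlled on the boundary, where |z| is at least rho. *)
Lemma schwarz_step G H (rho M : R) : 0 < rho -> (forall z, jet2 G z) -> jet2 H 0 ->
  (forall z, z != 0 -> H z = z^-1 *: (G z - G 0)) ->
  (forall z, square rho z -> nr (G z) <= M) ->
  (forall z, jet2 H z) /\ (forall z, square rho z -> nr (H z) <= M * (2 / rho)).
Proof.
move=> rho0 Gj H0 HE GM.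
have Hj z : jet2 H z.
  have [->//|z0] := eqVneq z 0.
  have nz0 : 0 < nr z by rewrite lt_neqAle nr_ge0 andbT eq_sym; apply: contra_neq z0 => /nr0_eq0.
  apply: (@jet2_ext (fun z => z^-1 *: (G z - G 0)) _ _ (nr z)) => //.
    move=> w wz; rewrite HE//; apply/eqP => zw.
    by have := nrB (z + w) w; rewrite addrK zw nr0; lra.
  by apply: jet2_divz => //; apply: jet2B => //; apply: jet2_cst.
split=> //; apply: max_principle => // z zQ rz.
have z0 : z != 0 by apply/eqP => z0; move: rz; rewrite z0 nr0; lra.
rewrite HE// nrZ nrV; have := GM _ zQ.
have : nr (G 0) <= M by apply: GM; split; rewrite /= normr0 ltW.
have := nrB (G z) (G 0) => a b c.
rewrite mulrA mulrC; apply: ler_pM => //; rewrite ?nr_ge0 ?invr_ge0 ?nr_ge0//; first lra.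
by rewrite lef_pV2 ?posrE//; lra.
Qed.

(** Iterating schwarz_step on the successive remainders F_{n+1} = (F_n - a_n)
    / z gives Cauchy's estimates and, at the same time, the convergence of the
    Taylor series on the whole square, without any contour integral and
    without re-expanding power series. *)
Lemma cauchy_taylor F (a : nat -> Y) (r rho M : R) :
  (forall z, jet2 F z) -> 0 < r ->
  (forall w, nr w < r -> sconv (fun n => \sum_(k < n) w ^+ k *: a k) (F w)) ->
  0 < rho -> (forall z, square rho z -> nr (F z) <= M) ->
  forall n, nr (a n) <= M * (2 / rho) ^+ n /\
    forall z, square rho z ->
      nr (F z - \sum_(k < n) z ^+ k *: a k) <= M * (2 / rho) ^+ n * nr z ^+ n.
Proof.
move=> Fj r0 Fa rho0 FM n.
have series0 (H : R[i] -> Y) (b : nat -> Y) :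
    (forall w, nr w < r -> sconv (fun n => \sum_(k < n) w ^+ k *: b k) (H w)) -> H 0 = b 0.
  move=> Hb; have := Hb 0; rewrite nr0 => /(_ r0) /(sconv_shift _ _).2 Hb0.
  apply: (sconv_uniq Hb0).
  under [X in sconv X]eq_fun => m.
    rewrite big_ord_recl /= expr0 scale1r big1 ?addr0; last first.
      by move=> i _; rewrite expr0n scale0r.
    over.
  exact: sconv_cst.
suff [G [Gj Ga GM GF]] : exists G : R[i] -> Y, [/\ forall z, jet2 G z,
    forall w, nr w < r -> sconv (fun m => \sum_(k < m) w ^+ k *: a (n + k)%N) (G w),
    forall z, square rho z -> nr (G z) <= M * (2 / rho) ^+ n &
    forall z, F z = \sum_(k < n) z ^+ k *: a k + z ^+ n *: G z].
  split=> [|z zQ].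
    have := series0 G (fun k => a (n + k)%N) Ga; rewrite addn0 => <-.
    by apply: GM; split; rewrite /= normr0 ltW.
  rewrite GF addrC addKr nrZ nrX mulrC; apply: ler_wpM2r; last exact: GM.
  by rewrite exprn_ge0// nr_ge0.
elim: n => [|n [G [Gj Ga GM GF]]].
  exists F; split=> // z; first by rewrite expr0 mulr1; apply: FM.
  by rewrite big_ord0 add0r expr0 scale1r.
have G0 : G 0 = a n by rewrite (series0 G (fun k => a (n + k)%N) Ga) addn0.
pose H z := if z == 0 then a n.+1 else z^-1 *: (G z - G 0).
have Ha w : nr w < r -> sconv (fun m => \sum_(k < m) w ^+ k *: a (n.+1 + k)%N) (H w).
  move=> wr; rewrite /H; have [->|w0] := eqVneq w 0.
    apply/sconv_shift; under [X in sconv X]eq_fun => m.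
      rewrite big_ord_recl /= expr0 scale1r addn0 big1 ?addr0; last first.
        by move=> i _; rewrite expr0n scale0r.
      over.
    exact: sconv_cst.
  have := sconvZ w^-1 (sconvB (Ga _ wr) (sconv_cst (G 0))) => /(sconv_shift _ _).2.
  congr sconv; apply/funext => m.
  rewrite big_ord_recl /= expr0 scale1r addn0 -G0 addrC addKr scaler_sumr.
  by apply: eq_bigr => i _; rewrite scalerA exprS mulKf// addSnnS.
have H0 : jet2 H 0.
  apply: (@power_series_jet2 _ _ (fun k => a (n.+1 + k)%N) r) => // w wr.
  by rewrite add0r; apply: Ha.
have [|Hj HM] := schwarz_step rho0 Gj H0 _ GM.
  by move=> z z0; rewrite /H (negPf z0).
exists H; split=> // z; first by move/HM; rewrite -(mulrA M) -exprSr.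
rewrite GF big_ord_recr /= -addrA; congr (_ + _).
rewrite exprSr -scalerA -scalerDr /H; congr (_ *: _).
have [->|z0] := eqVneq z 0; first by rewrite scale0r addr0 G0.
by rewrite scalerA mulfV// scale1r G0 addrC subrK.
Qed.

End OneVariable.

(** * Bounded sets and bounded linear maps *)

Section Bridges.
Context {R : realType}.

Lemma bounded_setP (V : normedModType R[i]) (B : set V) :
  bounded_set B <-> exists2 M : R, 0 < M & forall x, B x -> nr x < M.
Proof.
split=> [/ex_strict_bound_gt0[_ /gt0_complexP[M M0 ->] BM]|[M M0 BM]].
  by exists M => // x /BM /=; rewrite nr_ltP.
exists M%:C; split; first by rewrite ger0_real// lecR ltW.
move=> N MN x /BM xM /=; apply: le_trans (ltW MN).
by rewrite nr_leP ltW.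
Qed.

Lemma continuous_linearP (V W : normedModType R[i]) (f : {linear V -> W}) :
  continuous f <-> exists2 c : R, 0 <= c & forall x, nr (f x) <= c * nr x.
Proof.
split=> [/linear_bounded_continuous/linear_boundedP/pinfty_ex_gt0|[c c0 fc]].
  move=> [_ /gt0_complexP[c c0 ->] fc]; exists c; first exact: ltW.
  by move=> x; have := fc x; rewrite !normE -rmorphM lecR.
apply/linear_bounded_continuous/linear_boundedP.
exists c%:C; split; first by rewrite ger0_real// lecR.
move=> r cr x; apply: (@le_trans _ _ (c%:C * `|x|)).
  by rewrite !normE -rmorphM lecR.
by rewrite ler_wpM2r// ltW.
Qed.

End Bridges.

(** * Infimal convolution of seminorms *)

Section OrdSums.

Lemma big_ord_split (V : nmodType) (F : nat -> V) m M : (m <= M)%N ->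
  \sum_(k < M) F k = \sum_(k < m) F k + \sum_(i < M - m) F (m + i)%N.
Proof.
move=> mM; rewrite -[LHS](big_mkord predT) (big_cat_nat (leq0n m) mM)/= big_mkord.
congr (_ + _); rewrite -[X in index_iota X _]add0n big_addn big_mkord.
by under eq_bigr do rewrite addnC.
Qed.

Lemma big_ord_pad (V : nmodType) (F : nat -> V) L M : (L <= M)%N ->
  (forall k, (L <= k)%N -> F k = 0) -> \sum_(k < M) F k = \sum_(k < L) F k.
Proof.
move=> LM F0; rewrite (big_ord_split _ LM) [X in _ + X]big1 ?addr0// => i _.
by rewrite F0// leq_addr.
Qed.

Lemma ler_sum_ord (R : numDomainType) (F : nat -> R) m M : (m <= M)%N ->
  (forall k, 0 <= F k) -> \sum_(k < m) F k <= \sum_(k < M) F k.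
Proof. by move=> mM F0; rewrite (big_ord_split _ mM) lerDl sumr_ge0. Qed.

End OrdSums.

Section Seminorms.
Context {R : realType} {X : lmodType R[i]}.

Lemma sn_sumD (I : Type) (s : seq I) (p : I -> seminorm X) x y :
  \sum_(i <- s) p i (x + y) <= \sum_(i <- s) p i x + \sum_(i <- s) p i y.
Proof. by rewrite -big_split; apply: ler_sum => i _; apply: snD. Qed.

Lemma sn_sumZ (I : Type) (s : seq I) (p : I -> seminorm X) (c : R[i]) x :
  \sum_(i <- s) p i (c *: x) = nr c * \sum_(i <- s) p i x.
Proof. by rewrite mulr_sumr; apply: eq_bigr => i _; rewrite snZ. Qed.

Definition sum_sn (I : Type) (s : seq I) (p : I -> seminorm X) : seminorm X :=
  Seminorm (sn_sumD s p) (sn_sumZ s p).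

Lemma sn_scaleD (c : {nonneg R}) (p : seminorm X) x y :
  c%:num * p (x + y) <= c%:num * p x + c%:num * p y.
Proof. by rewrite -mulrDr ler_wpM2l// snD. Qed.

Lemma sn_scaleZ (c : {nonneg R}) (p : seminorm X) (d : R[i]) x :
  c%:num * p (d *: x) = nr d * (c%:num * p x).
Proof. by rewrite snZ mulrCA. Qed.

Definition scale_sn (c : {nonneg R}) (p : seminorm X) : seminorm X :=
  Seminorm (sn_scaleD c p) (sn_scaleZ c p).

Definition add_sn (p q : seminorm X) : seminorm X :=
  sum_sn [:: true; false] (fun b => if b then p else q).

Lemma add_snE p q x : add_sn p q x = p x + q x.
Proof. by rewrite /= !big_cons big_nil addr0. Qed.

Section InfConvolution.
Variable N : nat -> seminorm X.

(** Letting the pieces vanish from the index L on allows L to be enlarged at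
    will, so that two decompositions can be added. *)
Definition decomposition (x : X) (t : R) : Prop := exists L (s : nat -> X),
  [/\ forall k, (L <= k)%N -> s k = 0, x = \sum_(k < L) s k
    & t = \sum_(k < L) N k (s k)].

(** The gauge of the absolutely convex hull of the union of the unit balls of
    the seminorms N k. *)
Definition infconv (x : X) : R := inf [set t | decomposition x t].

Lemma decomposition_single k x : decomposition x (N k x).
Proof.
exists k.+1, (fun i => if i == k then x else 0); split.
- by move=> i ki; rewrite gtn_eqF.
- rewrite big_ord_recr /= eqxx big1 ?add0r// => i _.
  by rewrite ltn_eqF.
- rewrite big_ord_recr /= eqxx big1 ?add0r// => i _.
  by rewrite ltn_eqF// sn0.
Qed.

Lemma decomposition_ge0 x t : decomposition x t -> 0 <= t.
Proof. by move=> [L [s [_ _ ->]]]; apply: sumr_ge0 => k _; apply: sn_ge0. Qed.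

Lemma decomposition_has_inf x : has_inf [set t | decomposition x t].
Proof.
split; first by exists (N 0 x); apply: decomposition_single.
by exists 0 => t /decomposition_ge0.
Qed.

Lemma infconv_le_dec x t : decomposition x t -> infconv x <= t.
Proof. by move=> xt; apply: ge_inf => //; exact: (decomposition_has_inf x).2. Qed.

Lemma infconv_le k x : infconv x <= N k x.
Proof. exact/infconv_le_dec/decomposition_single. Qed.

Lemma infconv_lt x e : infconv x < e -> exists2 t, decomposition x t & t < e.
Proof.
move=> xe; have e0 : 0 < e - infconv x by rewrite subr_gt0.
have [t xt te] := inf_adherent e0 (decomposition_has_inf x).
by exists t => //; move: te; rewrite -/(infconv x) subrKC.
Qed.

Lemma infconvD x y : infconv (x + y) <= infconv x + infconv y.
Proof.
apply/ler_addgt0Pr => e e0; have e2 : 0 < e / 2 by lra.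
have [|t [L [s [s0 xE tE]]] te] := @infconv_lt x (infconv x + e / 2); first by lra.
have [|u [M [r [r0 yE uE]]] ue] := @infconv_lt y (infconv y + e / 2); first by lra.
apply: (@le_trans _ _ (t + u)); last by lra.
apply: (@le_trans _ _ (\sum_(k < maxn L M) N k (s k + r k))).
  apply: infconv_le_dec; exists (maxn L M), (fun k => s k + r k); split => //.
    by move=> k; rewrite geq_max => /andP[/s0 -> /r0 ->]; rewrite addr0.
  by rewrite big_split /= !(big_ord_pad _ s0, big_ord_pad _ r0) ?leq_maxl ?leq_maxr -?xE -?yE.
rewrite tE uE -(@big_ord_pad _ (fun k => N k (s k)) _ _ (leq_maxl L M)); last first.
  by move=> k /s0 ->; rewrite sn0.
rewrite -(@big_ord_pad _ (fun k => N k (r k)) _ _ (leq_maxr L M)); last first.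
  by move=> k /r0 ->; rewrite sn0.
by rewrite -big_split; apply: ler_sum => k _; apply: snD.
Qed.

Lemma infconvZ_le (c : R[i]) x t : decomposition x t -> infconv (c *: x) <= nr c * t.
Proof.
move=> [L [s [s0 -> ->]]]; apply: infconv_le_dec; exists L, (fun k => c *: s k).
split=> [k /s0 ->||]; rewrite ?scaler0 ?scaler_sumr//.
by rewrite mulr_sumr; apply: eq_bigr => k _; rewrite snZ.
Qed.

Lemma infconvZ_le2 (c : R[i]) x : infconv (c *: x) <= nr c * infconv x.
Proof.
apply/ler_addgt0Pr => e e0; have c0 : 0 < nr c + 1 by have := nr_ge0 c; lra.
have ec : 0 < e / (nr c + 1) by rewrite divr_gt0.
have [|t xt te] := @infconv_lt x (infconv x + e / (nr c + 1)); first by lra.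
apply: le_trans (infconvZ_le c xt) _.
have : e / (nr c + 1) * (nr c + 1) = e by rewrite divfK// gt_eqF.
by have := nr_ge0 c; nra.
Qed.

Lemma infconv_ge0 x : 0 <= infconv x.
Proof.
apply: lb_le_inf; first exact: (decomposition_has_inf x).1.
by move=> t /decomposition_ge0.
Qed.

Lemma infconvZ (c : R[i]) x : infconv (c *: x) = nr c * infconv x.
Proof.
apply/eqP; rewrite eq_le infconvZ_le2 /=.
have [->|c0] := eqVneq c 0; first by rewrite nr0 mul0r infconv_ge0.
have := infconvZ_le2 c^-1 (c *: x); rewrite scalerA mulVf// scale1r nrV.
have nc0 : 0 < nr c by rewrite lt_neqAle nr_ge0 andbT eq_sym; apply: contra_neq c0 => /nr0_eq0.
by rewrite -ler_pdivrMl ?invr_gt0// invrK.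
Qed.

Definition infconv_sn : seminorm X := Seminorm infconvD infconvZ.

End InfConvolution.
End Seminorms.

(** * Total boundedness of bounded sets *)

Section NormedSeminorms.
Context {R : realType} {X : normedModType R[i]}.

Definition norm_sn : seminorm X := Seminorm (@nrD R X) (@nrZ R X).

(** Total boundedness of balls is expressed by a finite colouring, the
    distance between two points of the same colour being small: colourings
    combine under products, which handles finite sums of seminorms. *)
Definition totally_bounded_sn (p : seminorm X) : Prop := forall r e : R, 0 < e ->
  exists (T : finType) (col : X -> T), forall x y,
    nr x <= r -> nr y <= r -> col x = col y -> p (x - y) < e.

Lemma totally_bounded_sum (I : finType) (p : I -> seminorm X) :
  (forall i, totally_bounded_sn (p i)) -> totally_bounded_sn (sum_sn (index_enum I) p).
Proof.
move=> pt r e e0; have n0 : 0 < (#|I|.+1%:R : R) by rewrite ltr0n.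
have /choice[T hT] : forall i : I, exists T : finType, exists col : X -> T, forall x y,
    nr x <= r -> nr y <= r -> col x = col y -> p i (x - y) < e / #|I|.+1%:R.
  by move=> i; have [T [c h]] := pt i r _ (divr_gt0 e0 n0); exists T, c.
have hc i : {col : X -> T i | forall x y,
    nr x <= r -> nr y <= r -> col x = col y -> p i (x - y) < e / #|I|.+1%:R}.
  exact: cid (hT i).
exists {dffun forall i, T i}, (fun x => [ffun i => projT1 (hc i) x]) => x y xr yr /ffunP xy /=.
apply: (@le_lt_trans _ _ (\sum_(i : I) e / #|I|.+1%:R)).
  apply: ler_sum => i _; apply: ltW; apply: (projT2 (hc i)) => //.
  by have := xy i; rewrite !ffunE.
rewrite sumr_const -(mulr_natr (e / _)) -mulrA -[X in _ < X]mulr1 ltr_pM2l//.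
by rewrite mulrC ltr_pdivrMr// mul1r ltr_nat.
Qed.

Lemma totally_bounded_scale (c : {nonneg R}) (p : seminorm X) :
  totally_bounded_sn p -> totally_bounded_sn (scale_sn c p).
Proof.
move=> pt r e e0; have c0 : 0 < c%:num + 1 by rewrite ltr_wpDl.
have [T [col h]] := pt r _ (divr_gt0 e0 c0).
exists T, col => x y xr yr xy /=; have := h _ _ xr yr xy.
by rewrite ltr_pdivlMr//; have := sn_ge0 p (x - y); lra.
Qed.

Lemma real_coloring (g : X -> R) (r K e : R) : 0 < e ->
  (forall x, nr x <= r -> `|g x| <= K) ->
  exists (T : finType) (col : X -> T), forall x y, nr x <= r -> nr y <= r ->
    col x = col y -> `|g x - g y| < e.
Proof.
move=> e0 gK; pose h x := (g x + K) / e.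
have h0 x : nr x <= r -> 0 <= h x.
  by move/gK; rewrite ler_norml => /andP[? _]; rewrite divr_ge0//; lra.
pose M := Num.truncn ((2 * K) / e).
have hM x : nr x <= r -> (Num.truncn (h x) < M.+1)%N.
  move=> xr; rewrite ltnS; apply: le_truncn.
  rewrite ler_pM2r ?invr_gt0//.
  by move: (gK _ xr); rewrite ler_norml => /andP[_ ?]; lra.
exists 'I_M.+1, (fun x => inord (Num.truncn (h x))) => x y xr yr /(congr1 val) /=.
rewrite !inordK ?hM// => xy.
have /andP[x1 x2] := truncn_itv (h0 _ xr); have /andP[y1 y2] := truncn_itv (h0 _ yr).
have hxy : `|h x - h y| < 1.
  by rewrite ltr_norml; move: x1 x2 y1 y2; rewrite xy -natr1 => *; lra.
have -> : g x - g y = (h x - h y) * e by rewrite /h -mulrBl divfK ?gt_eqF//; ring.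
by rewrite normrM (gtr0_norm e0) -ltr_pdivlMr// divff ?gt_eqF.
Qed.

Section Functional.
Variable phi : {linear X -> R[i]^o}.

Lemma functional_snD x y : nr (phi (x + y) : R[i]) <= nr (phi x : R[i]) + nr (phi y : R[i]).
Proof. by rewrite linearD nrD. Qed.

Lemma functional_snZ (c : R[i]) x : nr (phi (c *: x) : R[i]) = nr c * nr (phi x : R[i]).
Proof. by rewrite linearZ /= -nrM. Qed.

Definition functional_sn : seminorm X := Seminorm functional_snD functional_snZ.

Lemma totally_bounded_functional : continuous phi -> totally_bounded_sn functional_sn.
Proof.
move=> /continuous_linearP[c c0 hc] r e e0; have e2 : 0 < e / 2 by lra.
have cr x : nr x <= r -> nr (phi x : R[i]) <= c * r.
  by move=> xr; apply: le_trans (hc x) _; rewrite ler_wpM2l.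
have [|T1 [col1 h1]] := @real_coloring (fun x => complex.Re (phi x)) r (c * r) _ e2.
  by move=> x /cr; apply: le_trans; exact: Re_le_nr.
have [|T2 [col2 h2]] := @real_coloring (fun x => complex.Im (phi x)) r (c * r) _ e2.
  by move=> x /cr; apply: le_trans; exact: Im_le_nr.
exists (T1 * T2)%type, (fun x => (col1 x, col2 x)) => x y xr yr [xy1 xy2] /=.
apply: le_lt_trans (nr_ReIm _) _; rewrite linearB !raddfB.
by have := h1 _ _ xr yr xy1; have := h2 _ _ xr yr xy2; lra.
Qed.

End Functional.
End NormedSeminorms.

(** * The compact seminorm attached to a weakly uniformly continuous map *)

Section Core.
Context {R : realType} {X Y : normedModType R[i]}.
Variables (f : X -> Y) (p : nat -> seminorm X).
Hypothesis p_mono : forall j k x, (j <= k)%N -> p j x <= p k x.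
Hypothesis fp : forall k x y, nr x <= k.+1%:R ^+ 2 -> nr y <= k.+1%:R ^+ 2 ->
  p k (x - y) <= 1 -> nr (f x - f y) <= 2^-1 ^+ k.

Variable level_sn : nat -> seminorm X.
Hypothesis level_snE : forall k x,
  level_sn k x = k.+1%:R^-1 * nr x + 4 * k.+1%:R * p k x.

(** Together with p_level this makes the piece of index k of a decomposition
    at most k + 1 times as large as its cost in norm, but very small for p k:
    it may move far, only in directions that f hardly sees. *)
Lemma nr_level k x : nr x <= k.+1%:R * level_sn k x.
Proof.
rewrite level_snE mulrDr mulVKf ?pnatr_eq0// lerDl.
by rewrite !mulr_ge0 ?sn_ge0.
Qed.

Lemma p_level k x : 4 * k.+1%:R * p k x <= level_sn k x.
Proof. by rewrite level_snE lerDr mulr_ge0 ?nr_ge0// invr_ge0. Qed.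

Definition qsn : seminorm X := infconv_sn level_sn.

(** Truncating a decomposition of x at the index N. The discarded pieces s k,
    N <= k, change f by at most 2^-k each, by fp, because the partial sums
    stay in the ball of radius (k + 1)^2; they are also negligible for p N
    because p N <= p k. *)
Lemma qsn_approx (n N : nat) x : qsn x < n%:R -> (n <= N)%N -> exists u : X,
  [/\ nr u <= N.+1%:R ^+ 2, p N (x - u) <= 4^-1 & nr (f x - f u) <= 2 * 2^-1 ^+ N].
Proof.
move=> /infconv_lt[t [L [s [s0 xE tE]]] tn] nN.
have sN k : level_sn k (s k) <= n%:R.
  have [/s0 ->|kL] := leqP L k; first by rewrite sn0.
  apply: le_trans (ltW tn); rewrite tE (bigD1 (Ordinal kL))//= lerDl.
  by apply: sumr_ge0 => i _; apply: sn_ge0.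
have partial m : nr (\sum_(k < m) s k) <= m%:R * n%:R.
  apply: le_trans (nr_sum _ _ _) _.
  apply: (@le_trans _ _ (\sum_(k < m) m%:R * level_sn k (s k))).
    apply: ler_sum => k _; apply: le_trans (nr_level k _) _.
    by rewrite ler_wpM2r ?sn_ge0// ler_nat.
  rewrite -mulr_sumr ler_wpM2l// (le_trans _ (ltW tn))// tE.
  rewrite -(@big_ord_pad _ (fun k => level_sn k (s k)) L (maxn L m)) ?leq_maxl//.
    by apply: (@ler_sum_ord _ (fun k => level_sn k (s k))) => [|k]; [exact: leq_maxr | exact: sn_ge0].
  by move=> k /s0 ->; rewrite sn0.
have ps k : (N <= k)%N -> p k (s k) <= 1.
  move=> Nk; have := le_trans (p_level k (s k)) (sN k).
  have : (n%:R : R) <= k.+1%:R by rewrite ler_nat (leq_trans nN)// leqW.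
  have := sn_ge0 (p k) (s k); have : (0 : R) < k.+1%:R by rewrite ltr0n.
  nra.
have telescope m : nr (f (\sum_(k < N + m) s k) - f (\sum_(k < N) s k)) <=
    2 * 2^-1 ^+ N - 2 * 2^-1 ^+ (N + m).
  elim: m => [|m IH]; first by rewrite addn0 subrr nr0 subrr.
  apply: le_trans (nr_tri _ (f (\sum_(k < N + m) s k)) _) _.
  (* As n <= N + m, the partial sums stay in the ball where fp applies. *)
  have nNm : (n%:R : R) <= (N + m).+1%:R.
    by rewrite ler_nat (leq_trans nN)// (leq_trans (leq_addr m N)).
  have step : nr (f (\sum_(k < N + m.+1) s k) - f (\sum_(k < N + m) s k)) <= 2^-1 ^+ (N + m).
    rewrite addnS; apply: fp.
    - by apply: le_trans (partial _) _; rewrite expr2 ler_wpM2l.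
    - by apply: le_trans (partial _) _; rewrite expr2 ler_pM// ler_nat.
    - by rewrite big_ord_recr /= addrAC subrr add0r ps// leq_addr.
  have := exprS (2^-1 : R) (N + m); rewrite -addnS => e.
  by move: IH step; rewrite e; lra.
exists (\sum_(k < N) s k); split.
- apply: le_trans (partial _) _; rewrite expr2 ler_pM// ler_nat//.
  by rewrite (leq_trans nN).
- rewrite xE -(@big_ord_pad _ s L (maxn L N)) ?leq_maxl//.
  rewrite (big_ord_split _ (leq_maxr L N)) addrAC subrr add0r.
  apply: le_trans (sn_sum _ _ _ _) _.
  have N4 : (0 : R) < 4 * N.+1%:R by rewrite mulr_gt0.
  apply: (@le_trans _ _ (\sum_(i < maxn L N - N) level_sn (N + i) (s (N + i)%N) / (4 * N.+1%:R))).
    apply: ler_sum => i _; rewrite ler_pdivlMr// mulrC.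
    apply: le_trans (p_level _ _); apply: ler_pM; rewrite ?sn_ge0//.
      by rewrite ler_pM2l// ler_nat ltnS leq_addr.
    by apply: p_mono; rewrite leq_addr.
  rewrite -mulr_suml ler_pdivrMr//.
  apply: (@le_trans _ _ n%:R); last by rewrite mulrA mulVf// mul1r ler_nat leqW.
  apply: le_trans (ltW tn); rewrite tE.
  rewrite -(@big_ord_pad _ (fun k => level_sn k (s k)) L (maxn L N)) ?leq_maxl//.
    rewrite (@big_ord_split _ (fun k => level_sn k (s k)) _ _ (leq_maxr L N)) lerDr.
    by apply: sumr_ge0 => i _; apply: sn_ge0.
  by move=> k /s0 ->; rewrite sn0.
- rewrite xE -(@big_ord_pad _ s L (maxn L N)) ?leq_maxl//.
  have := telescope (maxn L N - N)%N; rewrite subnKC ?leq_maxr// => h; apply: le_trans h _.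
  by rewrite gerBl mulr_ge0// exprn_ge0.
Qed.

(** After truncation both points lie in the ball of radius (N + 1)^2, where p
    N controls f. *)
Lemma qsn_uniform (n N : nat) x y : qsn x < n%:R -> qsn y < n%:R -> (n <= N)%N ->
  p N (x - y) <= 2^-1 -> nr (f x - f y) <= 5 * 2^-1 ^+ N.
Proof.
move=> xn yn nN xy.
have [u [u1 u2 u3]] := qsn_approx xn nN; have [v [v1 v2 v3]] := qsn_approx yn nN.
have : p N (u - v) <= 1.
  have := sn_tri (p N) u x v; have := sn_tri (p N) x y v.
  by rewrite (snC _ u x) => ? ?; lra.
move=> /(fp u1 v1) uv; apply: le_trans (nr_tri _ (f u) _) _.
have := nr_tri (f u) (f v) (f y); rewrite (nrC (f v)); lra.
Qed.

(** On the finitely many pieces of index below k the seminorm p k is bounded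
    by the norm, on the other ones by p j. Hence the functionals that define p
    k stay continuous for the new seminorm. *)
Lemma p_le_qsn k (c : R) : 0 <= c -> (forall x, p k x <= c * nr x) ->
  exists2 C : R, 0 <= C & forall x, p k x <= C * qsn x.
Proof.
move=> c0 pc; have C0 : 0 <= c * k.+1%:R + 1 by rewrite addr_ge0// mulr_ge0.
exists (c * k.+1%:R + 1) => // x; apply/ler_addgt0Pr => e e0.
have C1 : 0 < c * k.+1%:R + 1 by rewrite ltr_wpDl// mulr_ge0.
have [|t [L [s [_ xE tE]]] te] := @infconv_lt _ _ level_sn x (qsn x + e / (c * k.+1%:R + 1)).
  by rewrite ltrDl divr_gt0.
apply: (@le_trans _ _ ((c * k.+1%:R + 1) * t)).
  rewrite xE tE mulr_sumr; apply: le_trans (sn_sum _ _ _ _) _; apply: ler_sum => j _.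
  have l0 := sn_ge0 (level_sn j) (s j).
  have [kj|/ltnW jk] := leqP k j.
    apply: le_trans (p_mono _ kj) _.
    apply: (@le_trans _ _ (1 * level_sn j (s j))); last first.
      by rewrite ler_wpM2r// lerDr mulr_ge0.
    rewrite mul1r; apply: le_trans (p_level _ _).
    rewrite ler_peMl ?sn_ge0//; have : (1 : R) <= j.+1%:R by rewrite ler1n.
    by lra.
  apply: le_trans (pc _) _; apply: (@le_trans _ _ (c * k.+1%:R * level_sn j (s j))).
    rewrite -mulrA ler_wpM2l//; apply: le_trans (nr_level j _) _.
    by rewrite ler_wpM2r// ler_nat.
  by rewrite ler_wpM2r// lerDl.
apply: (@le_trans _ _ ((c * k.+1%:R + 1) * (qsn x + e / (c * k.+1%:R + 1)))).
  by rewrite ler_pM2l// ltW.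
by rewrite mulrDr mulrCA mulfV ?mulr1// gt_eqF.
Qed.

(** The infimal convolution is at most level_sn k for every k. For large k the
    first summand of level_sn k is small on a given ball, and the second one
    is totally bounded. *)
Lemma qsn_totally_bounded : (forall k, totally_bounded_sn (p k)) -> totally_bounded_sn qsn.
Proof.
move=> pt r e e0.
have e2 : 0 < e / 2 by lra.
have [k kr] : exists k : nat, k.+1%:R^-1 * (2 * r) < e / 2.
  exists (Num.truncn (2 * r / (e / 2))); rewrite mulrC ltr_pdivrMr ?ltr0n//.
  by rewrite -[ltLHS]mulr1 -ltr_pdivrMl// mulr1 mulrC truncnS_gt.
have k4 : (0 : R) < 4 * k.+1%:R by rewrite mulr_gt0.
have [T [col h]] := pt k r _ (divr_gt0 e2 k4); exists T, col => x y xr yr xy.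
apply: le_lt_trans (infconv_le _ k _) _; rewrite level_snE.
have := h _ _ xr yr xy; rewrite ltr_pdivlMr// mulrC => hp.
have : k.+1%:R^-1 * nr (x - y) <= k.+1%:R^-1 * (2 * r).
  by rewrite ler_wpM2l ?invr_ge0//; have := nrB x y; lra.
move=> h1; rewrite [ltRHS]splitr ltrD//; exact: le_lt_trans h1 kr.
Qed.

End Core.

Section Package.
Context {R : realType} {X Y : normedModType R[i]}.

(** The factor 1 / (k + 1) makes the norm cheap at high levels, while the
    factor 4 * (k + 1) makes p k expensive. *)
Definition level_sn (p : nat -> seminorm X) (k : nat) : seminorm X :=
  add_sn (scale_sn (k.+1%:R^-1)%:nng norm_sn) (scale_sn (4 * k.+1%:R)%:nng (p k)).

Lemma level_snE p k x :
  level_sn p k x = k.+1%:R^-1 * nr x + 4 * k.+1%:R * p k x.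
Proof. exact: add_snE. Qed.

(** Up to domination, these are the seminorms that are continuous for the weak
    topology. *)
Definition weak_sn (b : seminorm X) : Prop :=
  exists n (phi : 'I_n -> {linear X -> R[i]^o}) (C : R),
    [/\ 0 < C, forall i, continuous (phi i) &
     forall x, b x = C * \sum_(i < n) nr (phi i x : R[i])].

Lemma wbu_weak_sn (f : X -> Y) : weakly_unif_cont_on_bounded f ->
  forall r e : R, 0 < e -> exists b : seminorm X, weak_sn b /\
    forall x y, nr x <= r -> nr y <= r -> b (x - y) <= 1 -> nr (f x - f y) <= e.
Proof.
move=> fw r e e0; have B : bounded_set [set x : X | nr x <= r].
  apply/bounded_setP; exists (`|r| + 1); first by have := normr_ge0 r; lra.
  by move=> x /= xr; have := ler_norm r; lra.
have [|U [n [phi [_ /gt0_complexP[d d0 ->] [phic dU]]]] fU] := fw _ B e%:C.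
  by rewrite ltcR.
have d1 : 0 <= 2 / d by rewrite divr_ge0// ltW.
exists (scale_sn (NngNum d1) (sum_sn (index_enum 'I_n) (fun i => functional_sn (phi i)))).
split; first by exists n, phi, (2 / d); split => //; rewrite divr_gt0.
move=> x y xr yr /= b1; apply: ltW; rewrite -nr_ltP; apply: fU => //.
apply: dU => i /=; rewrite nr_ltP.
have : nr (phi i (x - y) : R[i]) <= \sum_(i < n) nr (phi i (x - y) : R[i]).
  rewrite (bigD1 i)//= lerDl; apply: sumr_ge0 => j _; exact: nr_ge0.
move: b1; rewrite mulrAC ler_pdivrMr// mul1r; lra.
Qed.

Lemma weak_sn_witness (b : seminorm X) : weak_sn b ->
  {n : nat & {phi : 'I_n -> {linear X -> R[i]^o} & {C : R |
    [/\ 0 < C, forall i, continuous (phi i) &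
     forall x, b x = C * \sum_(i < n) nr (phi i x : R[i])]}}}.
Proof. by move=> /cid[n /cid[phi /cid[C h]]]; exists n, phi, C. Qed.

Lemma weak_sn_bounded (b : seminorm X) : weak_sn b ->
  exists2 c : R, 0 <= c & forall x, b x <= c * nr x.
Proof.
move=> [n [phi [C [C0 phic bE]]]].
have /choice[c hc] : forall i, exists c : R, 0 <= c /\ forall x, nr (phi i x : R[i]) <= c * nr x.
  by move=> i; have /continuous_linearP[c c0 h] := phic i; exists c.
exists (C * \sum_(i < n) c i).
  by apply: mulr_ge0; [exact: ltW | apply: sumr_ge0 => i _; case: (hc i)].
move=> x; rewrite bE -mulrA ler_pM2l// mulr_suml; apply: ler_sum => i _.
by case: (hc i).
Qed.

Lemma weak_sn_totally_bounded (b : seminorm X) : weak_sn b -> totally_bounded_sn b.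
Proof.
move=> [n [phi [C [C0 phic bE]]]].
have := @totally_bounded_sum _ _ _ (fun i => functional_sn (phi i))
  (fun i => totally_bounded_functional (phic i)).
move=> /(totally_bounded_scale (NngNum (ltW C0))) h r e e0.
by have [T [col hc]] := h r e e0; exists T, col => x y; rewrite bE; apply: hc.
Qed.

(** The infimal convolution of the levels is totally bounded on balls, so that
    the canonical map to its completion is a compact operator; but it is still
    strong enough for f to be controlled, on each of its balls, by finitely
    many functionals that are continuous for it. The last point is what makes
    the extension of f weakly uniformly continuous on bounded sets. *)
Theorem compact_seminorm (f : X -> Y) : weakly_unif_cont_on_bounded f ->
  exists q : seminorm X, [/\ exists2 C : R, 0 <= C & forall x, q x <= C * nr x,
    totally_bounded_sn q &
    forall r e : R, 0 < e -> exists m (phi : 'I_m -> {linear X -> R[i]^o}) (C d : R),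
      [/\ 0 <= C, 0 < d, forall i x, nr (phi i x : R[i]) <= C * q x &
      forall x y, q x < r -> q y < r ->
        (forall i, nr (phi i (x - y) : R[i]) < d) -> nr (f x - f y) <= e]].
Proof.
move=> fw.
have /choice[b hb] : forall k : nat, exists b : seminorm X, weak_sn b /\
    forall x y, nr x <= k.+1%:R ^+ 2 -> nr y <= k.+1%:R ^+ 2 -> b (x - y) <= 1 ->
      nr (f x - f y) <= 2^-1 ^+ k.
  by move=> k; apply: wbu_weak_sn => //; rewrite exprn_gt0.
pose p k := sum_sn (index_enum 'I_k.+1) (fun j : 'I_k.+1 => b j).
have b_p (j k : nat) x : (j <= k)%N -> b j x <= p k x.
  move=> jk; rewrite /= (bigD1 (Ordinal (jk : (j < k.+1)%N)))//= lerDl.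
  by apply: sumr_ge0 => i _; apply: sn_ge0.
have p_mono j k x : (j <= k)%N -> p j x <= p k x.
  by move=> jk; apply: (@ler_sum_ord _ (fun i => b i x)) => // i; apply: sn_ge0.
have fp k x y : nr x <= k.+1%:R ^+ 2 -> nr y <= k.+1%:R ^+ 2 ->
    p k (x - y) <= 1 -> nr (f x - f y) <= 2^-1 ^+ k.
  by move=> xk yk pk; apply: (hb k).2 => //; apply: le_trans pk; apply: b_p.
have p_bd k : exists2 c : R, 0 <= c & forall x, p k x <= c * nr x.
  have /choice[c hc] : forall j : 'I_k.+1, exists c : R, 0 <= c /\ forall x, b j x <= c * nr x.
    by move=> j; have [c c0 h] := weak_sn_bounded (hb j).1; exists c.
  exists (\sum_j c j); first by rewrite sumr_ge0// => j _; case: (hc j).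
  by move=> x; rewrite mulr_suml; apply: ler_sum => j _; case: (hc j).
exists (qsn (level_sn p)); split.
- have [c c0 hc] := p_bd 0%N; exists (1 + 4 * c); first by rewrite addr_ge0 ?mulr_ge0.
  move=> x; apply: le_trans (infconv_le _ 0 _) _; rewrite level_snE.
  by have := hc x; lra.
- apply: (qsn_totally_bounded (level_snE p)) => k; apply: totally_bounded_sum => j.
  exact: weak_sn_totally_bounded (hb j).1.
move=> r e e0.
have [n rn] : exists n : nat, r <= n%:R.
  by exists (Num.truncn r).+1; apply: ltW; apply: truncnS_gt.
have [N nN Ne] : exists2 N : nat, (n <= N)%N & 5 * 2^-1 ^+ N <= e.
  have /cvgrPdist_lt/(_ e e0)[M _ hM] : (fun N : nat => 5 * (2^-1 : R) ^+ N) @ \oo --> 0.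
    rewrite -[X in _ --> X](mulr0 5); apply: cvgM; first exact: cvg_cst.
    by apply: cvg_expr; rewrite ger0_norm; lra.
  exists (maxn n M); first exact: leq_maxl.
  have := hM (maxn n M) (leq_maxr _ _); rewrite /= sub0r normrN => h.
  by apply: ltW; apply: le_lt_trans h; apply: ler_norm.
have [c c0 hc] := p_bd N; have [C C0 hC] := p_le_qsn p_mono (level_snE p) c0 hc.
pose hd (j : 'I_N.+1) := weak_sn_witness (hb j).1.
pose n' j := projT1 (hd j).
pose phi j : 'I_(n' j) -> {linear X -> R[i]^o} := projT1 (projT2 (hd j)).
pose K j := projT1 (projT2 (projT2 (hd j))).
have hK j : [/\ 0 < K j, forall i, continuous (phi j i) &
    forall x, b j x = K j * \sum_(i < n' j) nr (phi j i x : R[i])].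
  exact: projT2 (projT2 (projT2 (hd j))).
clearbody K phi n'.
pose I := {j : 'I_N.+1 & 'I_(n' j)}.
pose Kn := \sum_(j < N.+1) K j * (n' j)%:R.
have Kn0 : 0 <= Kn.
  by apply: sumr_ge0 => j _; apply: mulr_ge0 => //; have [/ltW] := hK j.
exists #|{: I}|, (fun i => phi _ (tagged (enum_val i))),
  (\sum_(j < N.+1) C / K j), ((2 * (Kn + 1))^-1); split.
- by apply: sumr_ge0 => j _; apply: divr_ge0 => //; have [/ltW] := hK j.
- by rewrite invr_gt0 mulr_gt0// ltr_wpDl.
- move=> i x; move: (enum_val i) => [j k] /=; have [K0 _ bE] := hK j.
  apply: (@le_trans _ _ (C / K j * qsn (level_sn p) x)); last first.
    rewrite ler_wpM2r ?sn_ge0// (bigD1 j)//= lerDl.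
    by apply: sumr_ge0 => l _; apply: divr_ge0 => //; have [/ltW] := hK l.
  rewrite mulrAC ler_pdivlMr// mulrC; apply: le_trans (hC x).
  apply: (@le_trans _ _ (b j x)); last by apply: b_p; rewrite -ltnS ltn_ord.
  rewrite bE ler_pM2l// (bigD1 k)//= lerDl; apply: sumr_ge0 => l _; exact: nr_ge0.
move=> x y xr yr xy.
apply: le_trans Ne; apply: (qsn_uniform p_mono fp (level_snE p) _ _ nN).
- exact: lt_le_trans rn.
- exact: lt_le_trans rn.
apply: (@le_trans _ _ (\sum_(j < N.+1) K j * (n' j)%:R * (2 * (Kn + 1))^-1)); last first.
  rewrite -mulr_suml -/Kn ler_pdivrMr ?mulr_gt0 ?ltr_wpDl//.
  by rewrite mulrA mulVf// mul1r lerDl.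
apply: ler_sum => j _; have [K0 _ ->] := hK j.
rewrite -mulrA ler_pM2l// mulr_natl -[X in _ <= _ *+ X]card_ord -sumr_const.
apply: ler_sum => k _; apply: ltW.
by have := xy (enum_rank (Tagged (fun j => 'I_(n' j)) k : I)); rewrite enum_rankK.
Qed.
End Package.

(** * Polarization of homogeneous polynomials *)

Section Polarization.
Context {K : numFieldType}.
Implicit Types m : nat.

Definition update m (t : {ffun 'I_m -> 'I_m}) k0 i : {ffun 'I_m -> 'I_m} :=
  [ffun k => if k == k0 then i else t k].

(** All modifications of t at the positions listed in r; as a list it can be
    unfolded one position at a time. *)
Fixpoint reindexings m (r : seq 'I_m) (t : {ffun 'I_m -> 'I_m}) : seq {ffun 'I_m -> 'I_m} :=
  if r is k0 :: r' then flatten [seq reindexings r' (update t k0 i) | i <- enum 'I_m]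
  else [:: t].

Lemma reindexings_off m (r : seq 'I_m) (t s : {ffun 'I_m -> 'I_m}) k :
  s \in reindexings r t -> k \notin r -> s k = t k.
Proof.
elim: r t => [|k0 r IH] t /=; first by rewrite inE => /eqP ->.
move=> /flattenP[_ /mapP[i _ ->] /IH h]; rewrite inE negb_or => /andP[kk0 /h ->].
by rewrite ffunE (negPf kk0).
Qed.

Lemma mem_reindexings m (r : seq 'I_m) (t s : {ffun 'I_m -> 'I_m}) :
  (forall k, k \notin r -> s k = t k) ->
  s \in reindexings r t.
Proof.
elim: r t => [|k0 r IH] t st /=.
  by rewrite inE; apply/eqP/ffunP => k; apply: st.
apply/flattenP; exists (reindexings r (update t k0 (s k0))).
  by apply/mapP; exists (s k0) => //; rewrite mem_enum.
apply: IH => k kr; rewrite ffunE; case: eqP => [->//|/eqP kk0].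
by apply: st; rewrite inE negb_or kk0.
Qed.

Definition sgn (b : bool) : K := (-1) ^+ b.

Definition polar_weight m (s : {ffun 'I_m -> 'I_m}) : K :=
  \sum_(e : {ffun 'I_m -> bool}) (\prod_i sgn (e i)) * (\prod_k sgn (e (s k))).

Lemma polar_weight_inj m (s : {ffun 'I_m -> 'I_m}) : injective s ->
  polar_weight s = (2 ^ m)%:R.
Proof.
move=> si; rewrite /polar_weight (eq_bigr (fun=> 1)) => [|e _].
  by rewrite sumr_const card_ffun card_bool card_ord.
rewrite (reindex_inj si) /= -big_split /= big1// => i _.
by rewrite /sgn -expr2 sqrr_sign.
Qed.

(** If the index j is not a value of s, flipping the sign e j changes the sign
    of every term. *)
Lemma polar_weight_notinj m (s : {ffun 'I_m -> 'I_m}) : ~ injective s ->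
  polar_weight s = 0.
Proof.
move=> sninj; have [j js] : exists j, forall k, s k != j.
  apply: contrapT => /forallNP sj; apply: sninj.
  have surj j : exists k, s k = j.
    have /existsNP[k /negP] := sj j; rewrite negbK => /eqP <-; by exists k.
  suff h : #|[seq s x | x in 'I_m]| == #|'I_m|.
    by move=> x y; apply: (elimT (@image_injP _ _ s 'I_m) h).
  apply/eqP/eq_card => j; rewrite [RHS]inE; apply/mapP.
  by have [k <-] := surj j; exists k; rewrite ?mem_enum.
pose flip (e : {ffun 'I_m -> bool}) : {ffun 'I_m -> bool} :=
  [ffun i => if i == j then ~~ e i else e i].
have flipK : involutive flip.
  by move=> e; apply/ffunP => i; rewrite !ffunE; case: eqP => // _; rewrite negbK.
(* Only the factor of index j of the first product sees the flip. *)
have w2 : polar_weight s = - polar_weight s.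
  rewrite {1}/polar_weight (reindex_inj (inv_inj flipK)) /= -sumrN.
  apply: eq_bigr => e _; rewrite -mulNr; congr (_ * _); last first.
    by apply: eq_bigr => k _; rewrite ffunE (negPf (js k)).
  rewrite (bigD1 j)//= [in RHS](bigD1 j)//= -mulNr; congr (_ * _).
    by rewrite ffunE eqxx /sgn; case: (e j); rewrite ?opprK.
  by apply: eq_bigr => i ij; rewrite ffunE (negPf ij).
have : polar_weight s *+ 2 = 0 by rewrite mulr2n {1}w2 addNr.
by move/eqP; rewrite mulrn_eq0 /= => /eqP.
Qed.

Section Multilinear.
Variables (X Y : normedModType K) (m : nat) (A : ('I_m -> X) -> Y).
Hypothesis Aml : multilinear A.

Local Notation upd v i x := (@dfwith _ (fun=> X) v i x).

Lemma multilinear0 i v : A (upd v i 0) = 0.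
Proof.
have := Aml i v 1 0 0; rewrite /= !scale1r addr0 -[X in X = _]addr0.
by move=> /addrI <-.
Qed.

Lemma multilinearD i v x y : A (upd v i (x + y)) = A (upd v i x) + A (upd v i y).
Proof. by have := Aml i v 1 x y; rewrite /= !scale1r. Qed.

Lemma multilinearZ i v c x : A (upd v i (c *: x)) = c *: A (upd v i x).
Proof. by have := Aml i v c x 0; rewrite /= multilinear0 !addr0. Qed.

Lemma multilinear_sum i v (J : Type) (r : seq J) (a : J -> K) (h : J -> X) :
  A (upd v i (\sum_(j <- r) a j *: h j)) = \sum_(j <- r) a j *: A (upd v i (h j)).
Proof.
elim: r => [|j r IH]; first by rewrite !big_nil multilinear0.
by rewrite !big_cons multilinearD multilinearZ IH.
Qed.

Lemma multilinear_scale (c : K) (x : X) : A (fun=> c *: x) = c ^+ m *: A (fun=> x).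
Proof.
suff h (r : seq 'I_m) : uniq r ->
    A (fun k => if k \in r then c *: x else x) = c ^+ size r *: A (fun=> x).
  have := h (enum 'I_m) (enum_uniq _); rewrite size_enum_ord => <-.
  by congr A; apply/funext => k; rewrite mem_enum.
elim: r => [|k0 r IH] /=; first by rewrite scale1r.
move=> /andP[k0r /IH {}IH].
pose v k := if k \in r then c *: x else x.
have -> : (fun k => if k \in k0 :: r then c *: x else x) = upd v k0 (c *: x).
  apply/funext => k; case: dfwithP => [|j jk]; first by rewrite inE eqxx.
  by rewrite inE eq_sym (negPf jk).
rewrite multilinearZ exprS -scalerA -IH; congr (_ *: A _).
apply/funext => k; case: dfwithP => [|//]; by rewrite (negPf k0r).
Qed.

(** Expanding one slot at a time, the slots in r being still to be expanded
    and the other ones frozen by t. *)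
Lemma multilinear_expand (a : 'I_m -> K) (h : 'I_m -> X) (r : seq 'I_m)
    (t : {ffun 'I_m -> 'I_m}) : uniq r ->
  A (fun k => if k \in r then \sum_i a i *: h i else h (t k)) =
  \sum_(s <- reindexings r t) (\prod_(k <- r) a (s k)) *: A (fun k => h (s k)).
Proof.
elim: r t => [|k0 r IH] t /=; first by rewrite big_seq1 big_nil scale1r.
move=> /andP[k0r ru].
pose v k := if k \in r then \sum_i a i *: h i else h (t k).
have -> : (fun k => if k \in k0 :: r then \sum_i a i *: h i else h (t k)) =
    upd v k0 (\sum_i a i *: h i).
  apply/funext => k; case: dfwithP => [|j jk]; first by rewrite inE eqxx.
  by rewrite inE eq_sym (negPf jk).
rewrite multilinear_sum big_flatten big_map big_enum /=.
apply: eq_bigr => i _.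
have -> : upd v k0 (h i) = (fun k => if k \in r then \sum_i a i *: h i
                                     else h (update t k0 i k)).
  apply/funext => k; case: dfwithP => [|j jk]; first by rewrite (negPf k0r) ffunE eqxx.
  by rewrite /v ffunE (eq_sym j) (negPf jk).
rewrite IH// scaler_sumr [LHS]big_seq_cond [RHS]big_seq_cond; apply: eq_bigr => s.
rewrite andbT => sr; rewrite scalerA big_cons; congr (_ * _ *: _).
by rewrite (reindexings_off sr k0r) ffunE eqxx.
Qed.

End Multilinear.

(** The polarization formula, without its normalizing factor: it recovers a
    multilinear map from the polynomial alone, hence passes to limits of
    polynomials. *)
Definition polar (X Y : lmodType K) m (P : X -> Y) (h : 'I_m -> X) : Y :=
  \sum_(e : {ffun 'I_m -> bool}) (\prod_i sgn (e i)) *: P (\sum_i sgn (e i) *: h i).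

Definition all_reindexings m := reindexings (enum 'I_m) [ffun i : 'I_m => i].

Definition polar_constant m : K := \sum_(s <- all_reindexings m) polar_weight s.

(** The weights are 2^m or 0, and the identity contributes 2^m. *)
Lemma polar_constant_neq0 m : polar_constant m != 0.
Proof.
have w0 (s : {ffun 'I_m -> 'I_m}) : 0 <= polar_weight s.
  have [/polar_weight_inj -> //|/polar_weight_notinj ->//] := pselect (injective s).
have idm : [ffun i : 'I_m => i] \in all_reindexings m by apply: mem_reindexings.
rewrite gt_eqF// /polar_constant (big_rem _ idm) /=.
rewrite ltr_pwDl ?sumr_ge0// polar_weight_inj ?ltr0n ?expn_gt0//.
by move=> i j; rewrite !ffunE.
Qed.

Section PolarMultilinear.
Variables (X Y : normedModType K) (m : nat) (A : ('I_m -> X) -> Y).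
Hypothesis Aml : multilinear A.
Local Notation upd v i x := (@dfwith _ (fun=> X) v i x).

(** Only the reindexings that permute the slots survive the sum over signs. *)
Lemma polarE (h : 'I_m -> X) : polar (fun x => A (fun=> x)) h =
  \sum_(s <- all_reindexings m) polar_weight s *: A (fun k => h (s k)).
Proof.
rewrite /polar (eq_bigr (fun e : {ffun 'I_m -> bool} => \sum_(s <- all_reindexings m)
    ((\prod_i sgn (e i)) * (\prod_k sgn (e (s k)))) *: A (fun k => h (s k)))); last first.
  move=> e _.
  have -> : (fun=> \sum_i sgn (e i) *: h i) = (fun k : 'I_m => if k \in enum 'I_m then
      \sum_i sgn (e i) *: h i else h ([ffun i : 'I_m => i] k)).
    by apply/funext => k; rewrite mem_enum.
  rewrite (multilinear_expand Aml) ?enum_uniq// scaler_sumr.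
  by apply: eq_bigr => s _; rewrite scalerA big_enum.
rewrite exchange_big /=; apply: eq_bigr => s _.
by rewrite -scaler_suml.
Qed.

Lemma polar_diag (x : X) : polar (m := m) (fun x => A (fun=> x)) (fun=> x) =
  polar_constant m *: A (fun=> x).
Proof. by rewrite polarE scaler_suml. Qed.

Lemma polar_multilinear : multilinear (polar (m := m) (fun x => A (fun=> x))).
Proof.
move=> j h c x y /=; rewrite !polarE scaler_sumr -big_split; apply: eq_bigr => s _ /=.
have [si|/polar_weight_notinj ->] := pselect (injective s); last first.
  by rewrite !scale0r scaler0 addr0.
have [k0 k0j] : exists k0, s k0 = j.
  by have [g _ gK] := injF_bij si; exists (g j).
have H z : (fun k => upd h j z (s k)) = upd (fun k => h (s k)) k0 z.
  apply/funext => k; case: (eqVneq k k0) => [->|kk0].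
    by rewrite k0j !dfwithin.
  rewrite !dfwithout// ?[k0 == _]eq_sym//; apply: contra_neq kk0 => e.
  by apply: si; rewrite k0j.
rewrite !H (multilinearD Aml) (multilinearZ Aml) scalerDr !scalerA.
by rewrite [_ * c]mulrC.
Qed.

End PolarMultilinear.
End Polarization.

(** * Extension by density and power series *)

Section Uniform.
Context {R : realType}.

Lemma uniform_ball_sconv (X Y : normedModType R[i]) (u : nat -> X -> Y) (f : X -> Y) a (r : R) :
  {uniform ball a r%:C, u @ \oo --> f} ->
  forall x, nr (x - a) < r -> sconv (u^~ x) (f x).
Proof.
move=> uf x xa; apply/cvg_sconv.
have xB : [set x] `<=` ball a r%:C.
  by move=> _ ->; rewrite -ball_normE /= nr_ltP nrC.
by have := @uniform_subset_cvg _ _ _ _ _ _ _ xB uf; rewrite uniform_set1; apply.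
Qed.

Lemma uniform_ball_intro (X Y : normedModType R[i]) (u : nat -> X -> Y) (f : X -> Y) a (r : R) :
  (forall e : R, 0 < e -> exists N, forall n x, (N <= n)%N -> nr (x - a) < r ->
    nr (u n x - f x) < e) ->
  {uniform ball a r%:C, u @ \oo --> f}.
Proof.
move=> uf P /uniform_nbhs[E [+ EP]]; rewrite -entourage_ballE.
move=> [_ /gt0_complexP[e e0 ->] eE]; have [N hN] := uf e e0.
exists N => // n /= Nn; apply: EP => x; rewrite -ball_normE /= nr_ltP => xa.
by apply: eE => /=; rewrite -ball_normE /= nr_ltP nrC; apply: hN => //; rewrite nrC.
Qed.

Lemma continuous_nr (V W : normedModType R[i]) (F : V -> W) :
  (forall z (e : R), 0 < e -> exists2 d : R, 0 < d &
     forall w, nr (z - w) < d -> nr (F z - F w) < e) -> continuous F.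
Proof.
move=> hF z; apply/cvgrPdist_lt => _ /gt0_complexP[e e0 ->].
have [d d0 hd] := hF z e e0; near=> w; rewrite nr_ltP; apply: hd.
by rewrite -nr_ltP; near: w; apply: cvgr_dist_lt; rewrite ?ltcR.
Unshelve. all: by end_near. Qed.

(** The relation lim is left abstract so that the lemma applies to maps of one
    point and to maps of two points of a completion. *)
Lemma limit_extension (T E : Type) (V : normedModType R[i]) (lim : (nat -> T) -> E -> Prop)
    (h : T -> V) : seq_complete V -> (forall z, exists u, lim u z) ->
  (forall z u v, lim u z -> lim v z -> forall e : R, 0 < e ->
     exists N, forall n m, (N <= n)%N -> (N <= m)%N -> nr (h (u n) - h (v m)) < e) ->
  exists H : E -> V, forall z u, lim u z -> sconv (fun n => h (u n)) (H z).
Proof.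
move=> Vc dense hc.
have /choice[H hH] : forall z, exists l : V, forall u, lim u z -> sconv (fun n => h (u n)) l.
  move=> z; have [u uz] := dense z.
  have [|l ul] := Vc (fun n => h (u n)); first by move=> e e0; exact: (hc z u u).
  exists l => v vz; apply: sconv_close ul _ => e e0.
  by have [N hN] := hc z v u vz uz e e0; exists N => n Nn; apply: hN.
by exists H.
Qed.

Lemma finite_eventually (I : finType) (Q : I -> nat -> Prop) :
  (forall i, exists N, forall n, (N <= n)%N -> Q i n) ->
  exists N, forall n, (N <= n)%N -> forall i, Q i n.
Proof.
move=> /choice[N hN]; exists (\max_i N i)%N => n Nn i.
by apply: hN; apply: leq_trans Nn; apply: leq_bigmax.
Qed.

Lemma holomorphic_series (X Y : normedModType R[i]) (f : X -> Y) : holomorphic f ->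
  exists P : X -> nat -> X -> Y, forall a, (forall m, homogeneous_polynomial m (P a m)) /\
    exists2 r : R, 0 < r & forall x, nr x < r ->
      sconv (fun n => \sum_(k < n) P a k x) (f (a + x)).
Proof.
move=> fh; suff /choice[P hP] : forall a, exists P : nat -> X -> Y,
    (forall m, homogeneous_polynomial m (P m)) /\
    exists2 r : R, 0 < r & forall x, nr x < r -> sconv (fun n => \sum_(k < n) P k x) (f (a + x)).
  by exists P.
move=> a; have [_ /gt0_complexP[r r0 ->] [P Ph Pf]] := fh a; exists P; split => //.
exists r => // x xr; have := uniform_ball_sconv Pf (x := a + x).
rewrite addrC addKr => /(_ xr); congr sconv; apply/funext => n.
by rewrite big_mkord.
Qed.

Lemma homogeneous_polynomialZ (X Y : normedModType R[i]) m (P : X -> Y) (c : R[i]) x :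
  homogeneous_polynomial m P -> P (c *: x) = c ^+ m *: P x.
Proof. by move=> [_ [A Aml ->]]; exact: multilinear_scale. Qed.
End Uniform.

(** * Taylor expansions along complex lines *)

Section TaylorEstimates.
Context {R : realType} {X Y : normedModType R[i]}.
Variables (f : X -> Y) (P : X -> nat -> X -> Y).
Hypothesis P_hom : forall a m, homogeneous_polynomial m (P a m).
Hypothesis P_series : forall a, exists2 r : R, 0 < r & forall x, nr x < r ->
  sconv (fun n => \sum_(k < n) P a k x) (f (a + x)).

(** Restricting the power series to a complex line turns homogeneous
    polynomials into monomials. *)
Lemma line_series a h : exists2 r : R, 0 < r & forall w : R[i], nr w < r ->
  sconv (fun n => \sum_(k < n) w ^+ k *: P a k h) (f (a + w *: h)).
Proof.
have [r r0 Pr] := P_series a; have h1 : 0 < nr h + 1 by have := nr_ge0 h; lra.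
exists (r / (nr h + 1)); first by rewrite divr_gt0.
move=> w; rewrite ltr_pdivlMr// => wr.
have := Pr (w *: h); rewrite nrZ; have := nr_ge0 w; have := nr_ge0 h => a0 b0 /(_ _) H.
have := H ltac:(nra); congr sconv; apply/funext => n.
by apply: eq_bigr => k _; rewrite (homogeneous_polynomialZ _ _ (P_hom a k)).
Qed.

Lemma line_jet2 a h z : jet2 (fun w : R[i] => f (a + w *: h)) z.
Proof.
have [r r0 hr] := line_series (a + z *: h) h.
apply: (@power_series_jet2 _ _ _ _ (fun k => P (a + z *: h) k h) r) => // w /hr.
by rewrite scalerDl addrA.
Qed.

Lemma taylor_bound a h (rho M : R) : 0 < rho ->
  (forall w : R[i], nr w <= 2 * rho -> nr (f (a + w *: h)) <= M) ->
  forall n, nr (P a n h) <= M * (2 / rho) ^+ n /\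
    forall w : R[i], nr w <= rho ->
      nr (f (a + w *: h) - \sum_(k < n) w ^+ k *: P a k h) <= M * (2 / rho) ^+ n * nr w ^+ n.
Proof.
move=> rho0 fM n; have [r r0 hr] := line_series a h.
have [|h1 h2] := @cauchy_taylor _ _ (fun w => f (a + w *: h)) (fun k => P a k h) r rho M
  (line_jet2 a h) r0 hr rho0 _ n.
  by move=> z [z1 z2]; apply: fM; apply: le_trans (nr_ReIm z) _; lra.
split=> // w wr; apply: h2; split; apply: le_trans wr; [exact: Re_le_nr|exact: Im_le_nr].
Qed.

(** The difference of two restrictions to lines is again entire, so Cauchy's
    estimates apply to it; the coefficients depend on the base point and on
    the direction as uniformly as f does. *)
Lemma taylor_coef_dist a h a' h' (e : R) :
  (forall w : R[i], nr w <= 2 -> nr (f (a + w *: h) - f (a' + w *: h')) <= e) ->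
  forall n, nr (P a n h - P a' n h') <= e * 2 ^+ n.
Proof.
move=> fe n; have [r r0 hr] := line_series a h; have [s s0 hs] := line_series a' h'.
pose F w := f (a + w *: h) - f (a' + w *: h').
have Fj z : jet2 F z by apply: jet2B; apply: line_jet2.
have m0 : 0 < Num.min r s by rewrite lt_min r0.
have Fs w : nr w < Num.min r s ->
    sconv (fun n => \sum_(k < n) w ^+ k *: (P a k h - P a' k h')) (F w).
  rewrite lt_min => /andP[/hr wr /hs ws].
  have := sconvB wr ws; congr sconv; apply/funext => m.
  by rewrite -sumrB; apply: eq_bigr => k _; rewrite scalerBr.
have Fe z : square 1 z -> nr (F z) <= e.
  by move=> [z1 z2]; apply: fe; apply: le_trans (nr_ReIm z) _; lra.
have [H _] := @cauchy_taylor _ _ F (fun k => P a k h - P a' k h') _ _ _ Fj m0 Fs ltr01 Fe n.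
by rewrite divr1 in H.
Qed.

End TaylorEstimates.

(** * Taylor expansions controlled by a seminorm *)

Section SeminormEstimates.
Context {R : realType} {X Y : normedModType R[i]}.
Variables (f : X -> Y) (q : seminorm X) (P : X -> nat -> X -> Y).
Hypothesis P_hom : forall a m, homogeneous_polynomial m (P a m).
Hypothesis P_series : forall a, exists2 r : R, 0 < r & forall x, nr x < r ->
  sconv (fun n => \sum_(k < n) P a k x) (f (a + x)).
Hypothesis f_unif : forall r e : R, 0 < e -> exists2 d : R, 0 < d &
  forall x y, q x < r -> q y < r -> q (x - y) < d -> nr (f x - f y) <= e.

(** A point of the ball is joined to 0 by a number of equal steps that is
    fixed by r, each short enough to change f by at most 1. *)
Lemma bounded_on_balls (r : R) : exists2 M : R, 0 <= M & forall x, q x < r -> nr (f x) <= M.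
Proof.
have [d d0 hd] := f_unif r (ltr01 : 0 < 1).
have [K Kr] : exists K : nat, r / K.+1%:R < d.
  exists (Num.truncn (r / d)); rewrite ltr_pdivrMr ?ltr0n// mulrC -ltr_pdivrMr//.
  exact: truncnS_gt.
exists (nr (f 0) + K.+1%:R); first by rewrite addr_ge0 ?nr_ge0.
move=> x xr; have r0 : 0 < r by apply: le_lt_trans xr; apply: sn_ge0.
have K0 : (0 : R) < K.+1%:R by rewrite ltr0n.
pose t (j : nat) : R[i] := (j%:R / K.+1%:R)%:C.
have nt (j : nat) : nr (t j) = j%:R / K.+1%:R.
  by rewrite nr_real ger0_norm// divr_ge0.
have tr (j : nat) : (j <= K.+1)%N -> q (t j *: x) < r.
  move=> jK; rewrite snZ nt; apply: le_lt_trans xr.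
  by rewrite ler_piMl ?sn_ge0// ler_pdivrMr// mul1r ler_nat.
suff H (j : nat) : (j <= K.+1)%N -> nr (f (t j *: x)) <= nr (f 0) + j%:R.
  have := H _ (leqnn _); rewrite /t divff ?gt_eqF// scale1r; exact.
elim: j => [_|j IH jK]; first by rewrite /t mul0r scale0r addr0.
have step : nr (f (t j.+1 *: x) - f (t j *: x)) <= 1.
  apply: hd; [exact: tr|exact/tr/ltnW|].
  rewrite -scalerBl -rmorphB -mulrBl -natrB// subSnn snZ nr_real ger0_norm; last first.
    by rewrite divr_ge0.
  apply: lt_trans Kr; rewrite mul1r mulrC ltr_pM2r ?invr_gt0//.
have := nrD (f (t j.+1 *: x) - f (t j *: x)) (f (t j *: x)); rewrite subrK.
by have := IH (ltnW jK); rewrite -natr1; lra.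
Qed.

(** For |w| <= 2 the points a + w *: h stay in the ball of radius 3 * r, and
    the distances are multiplied by at most 3. *)
Lemma coef_uniform (n : nat) (r e : R) : 0 < e -> exists2 d : R, 0 < d &
  forall a h a' h', q a < r -> q h < r -> q a' < r -> q h' < r ->
    q (a - a') < d -> q (h - h') < d -> nr (P a n h - P a' n h') <= e.
Proof.
move=> e0; have e2 : 0 < e / 2 ^+ n by rewrite divr_gt0// exprn_gt0.
have [d d0 hd] := f_unif (3 * r) e2.
exists (d / 3); first by lra.
move=> a h a' h' ar hr ar' hr' aa hh.
have -> : e = e / 2 ^+ n * 2 ^+ n by rewrite divfK// expf_neq0.
apply: (taylor_coef_dist P_hom P_series) => w w2.
have small (u v : X) (s : R) : q u < s -> q v < s -> q (u + w *: v) < 3 * s.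
  move=> us vs; apply: le_lt_trans (snD _ _ _) _; rewrite snZ.
  by have := sn_ge0 q v; have := nr_ge0 w; nra.
apply: hd; [exact: small|exact: small|].
rewrite (_ : d = 3 * (d / 3)); last by lra.
by rewrite opprD addrACA -scalerBr; apply: small.
Qed.

(** Cauchy's estimates on the discs |w| <= 8 give a geometric convergence that
    is uniform over the unit ball of the seminorm: no radius of convergence in
    the original norm is involved. *)
Lemma taylor_remainder (r : R) : exists2 M : R, 0 <= M & forall a h n, q a < r -> q h < 1 ->
  nr (\sum_(k < n) P a k h - f (a + h)) <= M * 2^-1 ^+ n.
Proof.
have [M M0 hM] := bounded_on_balls (r + 8); exists M => // a h n ar h1.
have Mw (w : R[i]) : nr w <= 2 * 4 -> nr (f (a + w *: h)) <= M.
  move=> w8; apply: hM; apply: le_lt_trans (snD _ _ _) _; rewrite snZ.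
  by have := sn_ge0 q h; have := nr_ge0 w; nra.
have p4 : (0 : R) < 4 by [].
have [_ H] := taylor_bound P_hom P_series p4 Mw n.
have := H 1; rewrite nr1 scale1r expr1n mulr1 nrC.
rewrite (_ : 2 / 4 = 2^-1); last by lra.
under eq_bigr do rewrite expr1n scale1r.
by apply; lra.
Qed.

End SeminormEstimates.

(** * Limits in the completion *)

Section CompletionLimits.
Context {R : realType} {X : lmodType R[i]} (q : seminorm X).
Local Notation Z := (completion q).
Local Notation S := (to_completion q).
Implicit Types (u v : nat -> X) (z w : Z).

Definition slim u z : Prop := sconv (fun n => S (u n)) z.

Lemma slim_dense z : exists u, slim u z.
Proof.
have /choice[u hu] : forall n : nat, exists x, nr (S x - z) < n.+1%:R^-1.
  by move=> n; apply: to_completion_dense; rewrite invr_gt0.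
exists u => e e0; have := near_infty_natSinv_lt (PosNum e0) => -[N _ hN].
by exists N => n /hN /= ne; apply: lt_trans (hu n) ne.
Qed.

Lemma slim_cst x : slim (fun=> x) (S x).
Proof. exact: sconv_cst. Qed.

Lemma slimD u v z w : slim u z -> slim v w -> slim (fun n => u n + v n) (z + w).
Proof.
move=> uz vw; rewrite /slim; under [X in sconv X]eq_fun do rewrite linearD.
exact: sconvD.
Qed.

Lemma slimZ (c : R[i]) u z : slim u z -> slim (fun n => c *: u n) (c *: z).
Proof.
move=> uz; rewrite /slim; under [X in sconv X]eq_fun do rewrite linearZ.
exact: sconvZ.
Qed.

Lemma slimB u v z w : slim u z -> slim v w -> slim (fun n => u n - v n) (z - w).
Proof.
move=> uz vw; rewrite /slim; under [X in sconv X]eq_fun do rewrite linearB.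
exact: sconvB.
Qed.

Lemma slim_sum (I : Type) (r : seq I) (x : I -> nat -> X) (z : I -> Z) :
  (forall i, slim (x i) (z i)) -> slim (fun n => \sum_(i <- r) x i n) (\sum_(i <- r) z i).
Proof.
move=> xz; rewrite /slim; under [X in sconv X]eq_fun do rewrite linear_sum.
exact: sconv_sum.
Qed.

Lemma slim_lt u z (r : R) : slim u z -> nr z < r ->
  exists N, forall n, (N <= n)%N -> q (u n) < r.
Proof.
move=> uz zr; have [N hN] := sconv_nr_lt uz zr.
by exists N => n /hN; rewrite nr_to_completion.
Qed.

Lemma slim_close u v z (e : R) : slim u z -> slim v z -> 0 < e ->
  exists N, forall n m, (N <= n)%N -> (N <= m)%N -> q (u n - v m) < e.
Proof.
move=> uz vz e0; have e2 : 0 < e / 2 by lra.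
have [N1 h1] := uz _ e2; have [N2 h2] := vz _ e2.
exists (maxn N1 N2) => n m; rewrite !geq_max => /andP[/h1 hn _] /andP[_ /h2 hm].
rewrite -nr_to_completion linearB; apply: le_lt_trans (nr_tri _ z _) _.
by rewrite (nrC z); lra.
Qed.

(** The values along approximating sequences form Cauchy sequences by the
    bound on phi, and linearity passes to the limit. *)
Lemma functional_extension (phi : {linear X -> R[i]^o}) (C : R) : 0 <= C ->
  (forall x, nr (phi x : R[i]) <= C * q x) ->
  exists psi : {linear Z -> R[i]^o}, continuous psi /\
    forall u z, slim u z -> sconv (fun n => phi (u n) : R[i]) (psi z : R[i]).
Proof.
move=> C0 phiC.
have [|z u v uz vz e e0|psi hpsi] := @limit_extension _ _ _ R[i]^o (fun u z => slim u z) phi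
    complex_seq_complete; first exact: slim_dense.
  have C1 : 0 < C + 1 by lra.
  have [N hN] := slim_close uz vz (divr_gt0 e0 C1).
  exists N => n m Nn Nm; have := hN n m Nn Nm; rewrite ltr_pdivlMr//.
  rewrite -linearB; have := phiC (u n - v m); have := sn_ge0 q (u n - v m).
  by move=> a b; apply: le_lt_trans; nra.
have psi_lin : linear psi.
  move=> c z w; have [u uz] := slim_dense z; have [v vw] := slim_dense w.
  apply: (sconv_uniq (hpsi _ _ (slimD (slimZ c uz) vw))).
  under [X in sconv X]eq_fun do rewrite linearP.
  by apply: sconvD; [apply: sconvZ; apply: hpsi | apply: hpsi].
pose psiL : {linear Z -> R[i]^o} := HB.pack psi (GRing.isLinear.Build _ _ _ _ psi psi_lin).
exists psiL; split; last by move=> u z; apply: hpsi.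
apply/continuous_linearP; exists C => // z; have [u uz] := slim_dense z.
apply/ler_addgt0Pr => e e0; have C1 : 0 < C + 1 by lra.
have [|N hN] := slim_lt uz (r := nr z + e / (C + 1)).
  by rewrite ltrDl divr_gt0.
apply: (sconv_nr_le (hpsi _ _ uz) (N := N)) => n /hN qn; apply: le_trans (phiC _) _.
have : e / (C + 1) * (C + 1) = e by rewrite divfK// gt_eqF.
have : 0 < e / (C + 1) by rewrite divr_gt0.
by nra.
Qed.

End CompletionLimits.

(** * The holomorphic extension to the completion *)

Section Extension.
Context {R : realType} {X : normedModType R[i]} {Y : completeNormedModType R[i]}.
Variables (f : X -> Y) (q : seminorm X) (P : X -> nat -> X -> Y).
Local Notation Z := (completion q).
Local Notation S := (to_completion q).
Hypothesis P_hom : forall a m, homogeneous_polynomial m (P a m).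
Hypothesis P_series : forall a, exists2 r : R, 0 < r & forall x, nr x < r ->
  sconv (fun n => \sum_(k < n) P a k x) (f (a + x)).
Hypothesis f_unif : forall r e : R, 0 < e -> exists2 d : R, 0 < d &
  forall x y, q x < r -> q y < r -> q (x - y) < d -> nr (f x - f y) <= e.

Lemma extension_exists : exists g : Z -> Y, forall z u, slim u z ->
  sconv (fun n => f (u n)) (g z).
Proof.
apply: (limit_extension (@banach_seq_complete _ Y)); first exact: slim_dense.
move=> z u v uz vz e e0; have e2 : 0 < e / 2 by lra.
have [d d0 hd] := f_unif (nr z + 1) e2.
have zr : nr z < nr z + 1 by lra.
have [N1 h1] := slim_close uz vz d0; have [N2 h2] := slim_lt uz zr.
have [N3 h3] := slim_lt vz zr; exists (maxn N1 (maxn N2 N3)) => n m.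
rewrite !geq_max => /and3P[n1 n2 n3] /and3P[m1 m2 m3].
by apply: (@le_lt_trans _ _ (e / 2)); [apply: hd; auto|lra].
Qed.

Lemma coef_extension_exists n : exists H : Z -> Z -> Y, forall a h u v,
  slim u a -> slim v h -> sconv (fun k => P (u k) n (v k)) (H a h).
Proof.
have [||H hH] := @limit_extension _ (X * X)%type (Z * Z)%type Y
   (fun w z => slim (fun k => (w k).1) z.1 /\ slim (fun k => (w k).2) z.2)
   (fun w => P w.1 n w.2) (@banach_seq_complete _ Y); last first.
- exists (fun a h => H (a, h)) => a h u v ua vh.
  by apply: (hH (a, h) (fun k => (u k, v k))).
- move=> [a h] u v /= [ua uh] [va vh] e e0; have e2 : 0 < e / 2 by lra.
  set r := nr a + nr h + 1.
  have ar : nr a < r by have := nr_ge0 h; rewrite /r; lra.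
  have hr : nr h < r by have := nr_ge0 a; rewrite /r; lra.
  have [d d0 hd] := coef_uniform P_hom P_series f_unif n r e2.
  have [N1 h1] := slim_close ua va d0; have [N2 h2] := slim_close uh vh d0.
  have [N3 h3] := slim_lt ua ar; have [N4 h4] := slim_lt uh hr.
  have [N5 h5] := slim_lt va ar; have [N6 h6] := slim_lt vh hr.
  exists (maxn N1 (maxn N2 (maxn N3 (maxn N4 (maxn N5 N6))))) => k l.
  rewrite !geq_max => /and5P[k1 k2 k3 k4 /andP[k5 k6]] /and5P[l1 l2 l3 l4 /andP[l5 l6]].
  by apply: (@le_lt_trans _ _ (e / 2)); [apply: hd; auto|lra].
- move=> [a h]; have [u ua] := slim_dense a; have [v vh] := slim_dense h.
  by exists (fun k => (u k, v k)).
Qed.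

Variables (g : Z -> Y) (H : nat -> Z -> Z -> Y).
Hypothesis g_lim : forall z u, slim u z -> sconv (fun n => f (u n)) (g z).
Hypothesis H_lim : forall n a h u v,
  slim u a -> slim v h -> sconv (fun k => P (u k) n (v k)) (H n a h).

Lemma coef_extension_continuous n a : continuous (H n a).
Proof.
apply: continuous_nr => z e e0; have e2 : 0 < e / 2 by lra.
pose r := nr a + nr z + 2.
have [d d0 hd] := coef_uniform P_hom P_series f_unif n r e2.
exists (Num.min 1 d); first by rewrite lt_min ltr01.
move=> z'; rewrite lt_min => /andP[zz1 zzd].
have [u ua] := slim_dense a; have [v vz] := slim_dense z; have [w wz] := slim_dense z'.
have ar : nr a < r by have := nr_ge0 z; rewrite /r; lra.
have zr : nr z < r by have := nr_ge0 a; rewrite /r; lra.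
have zr' : nr z' < r.
  by have := nrB z (z - z'); rewrite opprB addrC subrK; have := nr_ge0 a; rewrite /r; lra.
have [N1 h1] := slim_lt ua ar; have [N2 h2] := slim_lt vz zr.
have [N3 h3] := slim_lt wz zr'; have [N4 h4] := slim_lt (slimB vz wz) zzd.
apply: (@le_lt_trans _ _ (e / 2)); last by lra.
apply: (sconv_nr_le (sconvB (H_lim n ua vz) (H_lim n ua wz))
  (N := maxn N1 (maxn N2 (maxn N3 N4)))) => k.
rewrite !geq_max => /and4P[k1 k2 k3 k4].
by apply: hd; auto; rewrite subrr sn0.
Qed.

Lemma polar_lim n a (h : 'I_n -> Z) u (w : nat -> 'I_n -> X) :
  slim u a -> (forall i, slim (fun k => w k i) (h i)) ->
  sconv (fun k => polar (P (u k) n) (w k)) (polar (H n a) h).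
Proof.
move=> ua wh; apply: sconv_sum => e; apply: sconvZ; apply: H_lim => //.
by apply: slim_sum => i; apply: slimZ.
Qed.

(** Polarization expresses multilinearity through values of the polynomial
    alone, so it survives the passage to the limit from the polynomials P (u
    k) n, in spite of the fact that the original multilinear maps need not be
    continuous. *)
Lemma coef_extension_polynomial n a : homogeneous_polynomial n (H n a).
Proof.
split; first exact: coef_extension_continuous.
have k0 := @polar_constant_neq0 R[i] n; have [u ua] := slim_dense a.
exists (fun h => (polar_constant n)^-1 *: polar (H n a) h).
  move=> j h c x y /=; rewrite scalerA [c * _]mulrC -scalerA -scalerDr; congr (_ *: _).
  have /choice[hs hsh] : forall i, exists w, slim w (h i) by move=> i; apply: slim_dense.
  have [xs xsx] := slim_dense x; have [ys ysy] := slim_dense y.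
  have upd_lim (ts : nat -> X) (t : Z) : slim ts t -> forall i,
      slim (fun k => @dfwith _ (fun=> X) (fun i => hs i k) j (ts k) i)
           (@dfwith _ (fun=> Z) h j t i).
    move=> tst i; case: (eqVneq j i) => [<-|ji].
      by rewrite dfwithin; under eq_fun do rewrite dfwithin.
    rewrite dfwithout//; under eq_fun do rewrite dfwithout//; exact: hsh.
  apply: (sconv_uniq (polar_lim ua (upd_lim _ _ (slimD (slimZ c xsx) ysy)))).
  have := sconvD (sconvZ c (polar_lim ua (upd_lim _ _ xsx))) (polar_lim ua (upd_lim _ _ ysy)).
  congr sconv; apply/funext => k.
  have [_ [A Aml ->]] := P_hom (u k) n.
  by rewrite (polar_multilinear Aml).
apply/funext => x; have [v vx] := slim_dense x.
apply: (@scalerI _ _ (polar_constant n)) => //; rewrite scalerA mulfV// scale1r.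
apply: (sconv_uniq (sconvZ _ (H_lim n ua vx))).
have := @polar_lim n a (fun=> x) u (fun k _ => v k) ua (fun=> vx).
congr sconv; apply/funext => k.
by have [_ [A Aml ->]] := P_hom (u k) n; rewrite (polar_diag Aml).
Qed.

(** The Taylor remainder bound on the dense subspace passes to the limit, so
    the extended coefficients sum to g uniformly on the unit ball around any
    point of the completion. *)
Lemma extension_holomorphic : holomorphic g.
Proof.
move=> a; exists 1; first exact: ltr01; exists (fun m => H m a).
  by move=> m; apply: coef_extension_polynomial.
have [M M0 hM] := taylor_remainder P_hom P_series f_unif (nr a + 1).
have [u ua] := slim_dense a.
apply: (@uniform_ball_intro _ _ _ _ _ a 1) => e e0.
have [N Ne] : exists N, forall n, (N <= n)%N -> M * 2^-1 ^+ n < e.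
  have /cvgrPdist_lt/(_ e e0)[N _ hN] : (fun N : nat => M * (2^-1 : R) ^+ N) @ \oo --> 0.
    rewrite -[X in _ --> X](mulr0 M); apply: cvgM; first exact: cvg_cst.
    by apply: cvg_expr; rewrite ger0_norm; lra.
  exists N => n /hN /=; rewrite sub0r normrN; apply: le_lt_trans; exact: ler_norm.
exists N => n x /Ne ne xa; apply: le_lt_trans ne; rewrite big_mkord.
have [v vx] := slim_dense (x - a).
have ua1 : nr a < nr a + 1 by lra.
have [N1 h1] := slim_lt ua ua1; have [N2 h2] := slim_lt vx xa.
have L : sconv (fun k => \sum_(m < n) P (u k) m (v k) - f (u k + v k))
    (\sum_(m < n) H m a (x - a) - g x).
  apply: sconvB; first by apply: sconv_sum => i; apply: H_lim.
  by apply: g_lim; have := slimD ua vx; rewrite subrKC.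
apply: (sconv_nr_le L (N := maxn N1 N2)) => k; rewrite geq_max => /andP[/h1 k1 /h2 k2].
exact: hM.
Qed.

Lemma extensionE x : g (S x) = f x.
Proof. by apply: (sconv_uniq (g_lim (slim_cst _ x))); apply: sconv_cst. Qed.

End Extension.

(** * Weak uniform continuity of the extension *)

Section WeakExtension.
Context {R : realType} {X : normedModType R[i]} {Y : normedModType R[i]}.
Variables (f : X -> Y) (q : seminorm X).
Local Notation Z := (completion q).
Hypothesis f_weak : forall r e : R, 0 < e ->
  exists m (phi : 'I_m -> {linear X -> R[i]^o}) (C d : R),
      [/\ 0 <= C, 0 < d, forall i x, nr (phi i x : R[i]) <= C * q x &
      forall x y, q x < r -> q y < r ->
        (forall i, nr (phi i (x - y) : R[i]) < d) -> nr (f x - f y) <= e].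

Lemma weak_uniform : forall r e : R, 0 < e -> exists2 d : R, 0 < d &
  forall x y, q x < r -> q y < r -> q (x - y) < d -> nr (f x - f y) <= e.
Proof.
move=> r e e0; have [m [phi [C [d [C0 d0 phiC hf]]]]] := f_weak r e0.
have C1 : 0 < C + 1 by lra.
exists (d / (C + 1)); first by rewrite divr_gt0.
move=> x y xr yr; rewrite ltr_pdivlMr// => xy; apply: hf => // i.
by apply: le_lt_trans (phiC _ _) _; have := sn_ge0 q (x - y); nra.
Qed.

Variable g : Z -> Y.
Hypothesis g_lim : forall z u, slim u z -> sconv (fun n => f (u n)) (g z).

(** The finitely many functionals that control f on a ball of the seminorm
    extend to the completion, and the inequality passes to the limit. *)
Lemma extension_wbu : weakly_unif_cont_on_bounded g.
Proof.
move=> B /bounded_setP[r r0 Br] _ /gt0_complexP[e e0 ->].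
have e2 : 0 < e / 2 by lra.
have [m [phi [C [d [C0 d0 phiC hf]]]]] := f_weak r e2.
have /choice[psi hpsi] : forall i, exists psi : {linear Z -> R[i]^o}, continuous psi /\
    forall u z, slim u z -> sconv (fun n => phi i (u n) : R[i]) (psi z : R[i]).
  by move=> i; apply: functional_extension C0 (phiC i).
exists [set z | forall i, `|psi i z| < d%:C].
  exists m, psi, d%:C; first by rewrite ltcR.
  by split => // i; case: (hpsi i).
move=> z w /Br zr /Br wr zw; rewrite nr_ltP.
have [u uz] := slim_dense z; have [v vw] := slim_dense w.
have [N1 h1] := slim_lt uz zr; have [N2 h2] := slim_lt vw wr.
have [N3 h3] : exists N, forall n, (N <= n)%N -> forall i, nr (phi i (u n - v n) : R[i]) < d.
  apply: finite_eventually => i; apply: sconv_nr_lt ((hpsi i).2 _ _ (slimB uz vw)) _.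
  by rewrite -nr_ltP; apply: zw.
apply: (@le_lt_trans _ _ (e / 2)); last by lra.
apply: (sconv_nr_le (sconvB (g_lim uz) (g_lim vw)) (N := maxn N1 (maxn N2 N3))) => n.
by rewrite !geq_max => /and3P[n1 n2 n3]; apply: hf; auto.
Qed.

End WeakExtension.

(** * Compactness of the canonical map and the factorization *)

Section Compactness.
Context {R : realType} {X : normedModType R[i]}.

(** A colouring gives a net by choosing one point of each colour. *)
Lemma to_completion_compact (q : seminorm X) (C : R) : 0 <= C ->
  (forall x, q x <= C * nr x) -> totally_bounded_sn q ->
  compact_operator (to_completion q).
Proof.
move=> C0 qC qtb; split.
  by apply/continuous_linearP; exists C => // x; rewrite nr_to_completion.
move=> B /bounded_setP[r r0 Br]; apply: precompact_of_net => e e0.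
have [T [col hcol]] := qtb r e e0.
pose rep (t : T) : X := xget 0 [set x | B x /\ col x = t].
exists [seq to_completion q (rep t) | t <- enum T] => _ [x Bx <-].
exists (to_completion q (rep (col x))).
  by apply: map_f; rewrite mem_enum.
rewrite -linearB nr_to_completion.
have [Brep crep] : B (rep (col x)) /\ col (rep (col x)) = col x.
  by rewrite /rep; case: xgetP => [y _ []//|/(_ x)]; case.
by apply: hcol => //; apply: ltW; apply: Br.
Qed.

End Compactness.

Lemma wbu_comp (R : realType) (X Y Z : normedModType R[i]) (S : {linear X -> Z}) (g : Z -> Y) :
  continuous S -> weakly_unif_cont_on_bounded g -> weakly_unif_cont_on_bounded (g \o S).
Proof.
move=> /[dup] Sc /continuous_linearP[c c0 hc] gw B /bounded_setP[r r0 Br] e e0.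
have SB : bounded_set (S @` B).
  apply/bounded_setP; exists (c * r + 1); first by rewrite ltr_wpDl// mulr_ge0// ltW.
  move=> _ [x /Br xr <-]; apply: le_lt_trans (hc x) _.
  by apply: (@le_lt_trans _ _ (c * r)); [rewrite ler_wpM2l// ltW | lra].
have [U [n [phi [d d0 [phic dU]]]] gU] := gw _ SB e e0.
exists (S @^-1` U).
  exists n, (fun i => phi i \o S : {linear X -> R[i]^o}), d => //; split.
    by move=> i x; apply: continuous_comp; [exact: Sc | exact: phic].
  by move=> x xd; apply: dU.
move=> x y Bx By /= Uxy; apply: gU; [exact: imageP|exact: imageP|by rewrite -linearB].
Qed.

Local Close Scope quotient_scope.
Local Close Scope complex_scope.

Theorem theorem16 (R : realType) (X Y : completeNormedModType R[i])
    (f : X -> Y) (hf : holomorphic f) :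
  holomorphic_wbu f <->
  exists (Z : completeNormedModType R[i]) (S : {linear X -> Z}) (g : Z -> Y),
    [/\ compact_operator S, holomorphic_wbu g & f = g \o S].
Proof.
split=> [[_ fw]|[Z [S [g [[Sc _] [_ gw] fE]]]]]; last first.
  by split=> //; rewrite fE; exact: wbu_comp.
have [q [[C C0 qC] qtb f_weak]] := compact_seminorm fw.
have f_unif := weak_uniform f_weak.
have [P hP] := holomorphic_series hf.
have P_hom a m := (hP a).1 m; have P_series a := (hP a).2.
have [g g_lim] := extension_exists f_unif.
have /choice[H H_lim] := coef_extension_exists P_hom P_series f_unif.
exists (completion q), (to_completion q), g; split.
- exact: to_completion_compact qC qtb.
- split; first exact: (extension_holomorphic P_hom P_series f_unif g_lim H_lim).
  exact: (extension_wbu f_weak g_lim).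
- by apply/funext => x /=; rewrite (extensionE g_lim).
Qed.
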